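(* Let $L$ be the Lie algebra freely generated by $P,Q$, let $\bar L=L/\bigl[[L,L],[L,L]\bigr]$, and let $\hat L$, $\widehat{\bar L}$ be the algebras of formal series of elements of $L$, $\bar L$. Under the natural projection $\hat L\to\widehat{\bar L}$ the Hausdorff series $H=\log\bigl(\exp(P)\cdot\exp(Q)\bigr)$ maps onto $$\bar H=P+Q+\sum_{m=1}^{\infty}\sum_{n=1}^{\infty}\frac{C_{mn}}{m!\,n!}[Q^{n-1}P^{m-1}QP].$$
   Context: Lie algebras are over $\mathbb{C}$. Long commutators: $[x_1x_2\ldots x_k]=[x_1,[x_2,[\ldots,x_k]\ldots]]$, powers denoting repeated letters, so $[Q^{n-1}P^{m-1}QP]=\mathrm{ad}_Q^{n-1}\mathrm{ad}_P^{m-1}[Q,P]$. Bernoulli numbers: $\sum_{n\ge0}\frac{B_n}{n!}x^n=\frac{x}{e^x-1}$. The extended Bernoulli numbers $C_{mn}$ ($m,n\ge1$) are defined recursively by $C_{1n}=B_n$ and $$C_{m+1,n}=\frac{n}{n+1}C_{m,n+1}-\frac{1}{n+1}\sum_{k=1}^{n}\binom{n+1}{k}B_kC_{m,n-k+1}\qquad(m,n\ge1).$$ *)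

(* Defs.v *)
From HB Require Import structures.
From mathcomp Require Import all_boot all_order all_algebra.
From mathcomp Require Import ring.
From mathcomp Require Import boolp classical_sets functions reals complex.

Set Implicit Arguments.
Unset Strict Implicit.
Unset Printing Implicit Defensive.

Import GRing.Theory.
Local Open Scope ring_scope.
Local Open Scope quotient_scope.
Local Open Scope classical_set_scope.

HB.mixin Record Lmodule_isLieAlgebra (K : fieldType) L of GRing.Lmodule K L := {
  lie : L -> L -> L;
  lie_linearl : forall (a : K) x y z,
    lie (a *: x + y) z = a *: lie x z + lie y z;
  lie_linearr : forall (a : K) x y z,
    lie x (a *: y + z) = a *: lie x y + lie x z;
  liexx : forall x, lie x x = 0;
  lie_jacobi : forall x y z,
    lie x (lie y z) + lie y (lie z x) + lie z (lie x y) = 0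
}.

#[short(type="lieAlgType")]
HB.structure Definition LieAlgebra (K : fieldType) :=
  { L of Lmodule_isLieAlgebra K L & GRing.Lmodule K L }.

Definition lie_morphism (K : fieldType) (L M : lieAlgType K) (f : L -> M) : Prop :=
  (forall (a : K) x y, f (a *: x + y) = a *: f x + f y) /\
  (forall x y, f (lie x y) = lie (f x) (f y)).

Section LieTheory.
Variables (K : fieldType) (L : lieAlgType K).
Implicit Types (x y z : L) (a : K).

Lemma lieDl x y z : lie (x + y) z = lie x z + lie y z.
Proof. by have := lie_linearl 1 x y z; rewrite !scale1r. Qed.

Lemma lieDr x y z : lie x (y + z) = lie x y + lie x z.
Proof. by have := lie_linearr 1 x y z; rewrite !scale1r. Qed.

Lemma lie0l x : lie 0 x = 0.
Proof. by apply: (@addrI _ (lie 0 x)); rewrite -lieDl !addr0. Qed.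

Lemma lie0r x : lie x 0 = 0.
Proof. by apply: (@addrI _ (lie x 0)); rewrite -lieDr !addr0. Qed.

Lemma lieZl a x y : lie (a *: x) y = a *: lie x y.
Proof. by have := lie_linearl a x 0 y; rewrite !addr0 lie0l addr0. Qed.

Lemma lieZr a x y : lie x (a *: y) = a *: lie x y.
Proof. by have := lie_linearr a x y 0; rewrite !addr0 lie0r addr0. Qed.

Lemma lieNl x y : lie (- x) y = - lie x y.
Proof. by rewrite -scaleN1r lieZl scaleN1r. Qed.

Lemma lieNr x y : lie x (- y) = - lie x y.
Proof. by rewrite -scaleN1r lieZr scaleN1r. Qed.

Lemma lieC x y : lie x y = - lie y x.
Proof.
apply/eqP; rewrite -addr_eq0; apply/eqP.
by have := liexx (x + y); rewrite lieDl !lieDr !liexx add0r addr0.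
Qed.

Lemma lie_leibniz x y z : lie x (lie y z) = lie (lie x y) z + lie y (lie x z).
Proof.
have /eqP := lie_jacobi x y z.
rewrite -addrA addr_eq0 => /eqP ->.
by rewrite opprD (lieC z x) lieNr opprK (lieC z (lie x y)) opprK addrC.
Qed.

(* The linear span of S. *)
Inductive lspan (S : set L) : L -> Prop :=
| lspan_zero : lspan S 0
| lspan_incr a x y : S x -> lspan S y -> lspan S (a *: x + y).

Lemma lspan_in S x : S x -> lspan S x.
Proof.
by move=> Sx; rewrite -(scale1r x) -(addr0 (1 *: x)); apply: lspan_incr => //; left.
Qed.

Lemma lspanD S x y : lspan S x -> lspan S y -> lspan S (x + y).
Proof.
elim=> [|a u v Su _ IH] Sy; first by rewrite add0r.
by rewrite -addrA; apply: lspan_incr => //; apply: IH.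
Qed.

Lemma lspanZ S a x : lspan S x -> lspan S (a *: x).
Proof.
elim=> [|b u v Su _ IH]; first by rewrite scaler0; left.
by rewrite scalerDr scalerA; apply: lspan_incr.
Qed.

Definition lie_prod (A B : set L) : set L :=
  lspan [set z | exists x y, [/\ A x, B y & z = lie x y]].

Record lie_ideal := LieIdeal {
  ideal_set :> L -> Prop;
  ideal0 : ideal_set 0;
  ideal_linear : forall a x y,
    ideal_set x -> ideal_set y -> ideal_set (a *: x + y);
  ideal_lie : forall x y, ideal_set y -> ideal_set (lie x y)
}.

Definition derived_set : set L := lie_prod setT setT.

Lemma derived_lie x y : derived_set (lie x y).
Proof. by apply: lspan_in; exists x, y. Qed.

Definition derived2_set : set L := lie_prod derived_set derived_set.

Lemma derived2_set_linear a x y :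
  derived2_set x -> derived2_set y -> derived2_set (a *: x + y).
Proof. by move=> hx hy; apply: lspanD => //; apply: lspanZ. Qed.

Lemma derived2_set_lie x y : derived2_set y -> derived2_set (lie x y).
Proof.
elim=> [|a u v [p [q [hp hq ->]]] _ IH]; first by rewrite lie0r; left.
rewrite lieDr lieZr; apply: derived2_set_linear => //.
rewrite lie_leibniz; apply: lspanD; apply: lspan_in.
  by exists (lie x p), q; split=> //; apply: derived_lie.
by exists p, (lie x q); split=> //; apply: derived_lie.
Qed.

Definition derived2 : lie_ideal :=
  LieIdeal (lspan_zero _) derived2_set_linear derived2_set_lie.

End LieTheory.

Section LieQuotient.
Variables (K : fieldType) (L : lieAlgType K) (I : lie_ideal L).
Implicit Types (x y z : L) (a : K).

Lemma idealZ a x : I x -> I (a *: x).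
Proof. by move=> Ix; rewrite -(addr0 (a *: x)); apply: ideal_linear => //; apply: ideal0. Qed.

Lemma idealD x y : I x -> I y -> I (x + y).
Proof. by move=> Ix Iy; rewrite -(scale1r x); apply: ideal_linear. Qed.

Lemma ideal_lier x y : I x -> I (lie x y).
Proof. by move=> Ix; rewrite lieC -scaleN1r; apply/idealZ/ideal_lie. Qed.

Definition lquot_eqv : rel L := fun x y => `[< I (x - y) >].

Lemma lquot_eqv_refl : reflexive lquot_eqv.
Proof. by move=> x; apply/asboolP; rewrite subrr; apply: ideal0. Qed.

Lemma lquot_eqv_sym : symmetric lquot_eqv.
Proof.
by move=> x y; apply/asboolP/asboolP => h; rewrite -opprB -scaleN1r; apply: idealZ.
Qed.

Lemma lquot_eqv_trans : transitive lquot_eqv.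
Proof.
move=> y x z /asboolP h1 /asboolP h2; apply/asboolP.
by rewrite -(subrKA y); apply: idealD.
Qed.

Canonical lquot_equiv :=
  EquivRel lquot_eqv lquot_eqv_refl lquot_eqv_sym lquot_eqv_trans.

Definition lquot := {eq_quot lquot_eqv}.
HB.instance Definition _ := Choice.on lquot.

Definition lquot_pi (x : L) : lquot := \pi_({eq_quot lquot_eqv}) x.

Lemma lquot_piP x y : lquot_pi x = lquot_pi y <-> I (x - y).
Proof.
split; first by move=> /eqmodP /asboolP.
by move=> h; apply/eqmodP/asboolP.
Qed.

Definition lquot_repr (u : lquot) : L := repr (u : {eq_quot lquot_eqv}).

Lemma lquot_reprK u : lquot_pi (lquot_repr u) = u.
Proof. exact: reprK. Qed.

Lemma lquot_pi_repr x : I (lquot_repr (lquot_pi x) - x).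
Proof. by apply/lquot_piP; rewrite lquot_reprK. Qed.

Lemma lquotW (Pr : lquot -> Prop) : (forall x, Pr (lquot_pi x)) -> forall u, Pr u.
Proof. by move=> h u; rewrite -(lquot_reprK u). Qed.

Definition lquot_add (u v : lquot) := lquot_pi (lquot_repr u + lquot_repr v).
Definition lquot_opp (u : lquot) := lquot_pi (- lquot_repr u).
Definition lquot_scale a (u : lquot) := lquot_pi (a *: lquot_repr u).
Definition lquot_lie (u v : lquot) := lquot_pi (lie (lquot_repr u) (lquot_repr v)).

Lemma lquot_piD x y : lquot_add (lquot_pi x) (lquot_pi y) = lquot_pi (x + y).
Proof.
by apply/lquot_piP; rewrite opprD addrACA; apply: idealD; apply: lquot_pi_repr.
Qed.

Lemma lquot_piN x : lquot_opp (lquot_pi x) = lquot_pi (- x).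
Proof.
by apply/lquot_piP; rewrite -opprD -scaleN1r; apply: idealZ; apply: lquot_pi_repr.
Qed.

Lemma lquot_piZ a x : lquot_scale a (lquot_pi x) = lquot_pi (a *: x).
Proof. by apply/lquot_piP; rewrite -scalerBr; apply: idealZ; apply: lquot_pi_repr. Qed.

Lemma lquot_pi_lie x y : lquot_lie (lquot_pi x) (lquot_pi y) = lquot_pi (lie x y).
Proof.
apply/lquot_piP; set x' := lquot_repr _; set y' := lquot_repr _.
have -> : lie x' y' - lie x y = lie (x' - x) y' + lie x (y' - y).
  by rewrite lieDl lieDr lieNl lieNr subrKA.
by apply: idealD; [apply: ideal_lier | apply: ideal_lie]; apply: lquot_pi_repr.
Qed.

Fact lquot_addA : associative lquot_add.
Proof.
by elim/lquotW=> x; elim/lquotW=> y; elim/lquotW=> z; rewrite !lquot_piD addrA.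
Qed.
Fact lquot_addC : commutative lquot_add.
Proof. by elim/lquotW=> x; elim/lquotW=> y; rewrite !lquot_piD addrC. Qed.
Fact lquot_add0 : left_id (lquot_pi 0) lquot_add.
Proof. by elim/lquotW=> x; rewrite lquot_piD add0r. Qed.
Fact lquot_addN : left_inverse (lquot_pi 0) lquot_opp lquot_add.
Proof. by elim/lquotW=> x; rewrite lquot_piN lquot_piD addNr. Qed.

HB.instance Definition _ := GRing.isZmodule.Build lquot
  lquot_addA lquot_addC lquot_add0 lquot_addN.

Fact lquot_scaleA a b (v : lquot) :
  lquot_scale a (lquot_scale b v) = lquot_scale (a * b) v.
Proof. by elim/lquotW: v => x; rewrite !lquot_piZ scalerA. Qed.
Fact lquot_scale1 : left_id 1 lquot_scale.
Proof. by elim/lquotW=> x; rewrite lquot_piZ scale1r. Qed.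
Fact lquot_scaleDr : right_distributive lquot_scale +%R.
Proof.
move=> a; elim/lquotW=> x; elim/lquotW=> y.
by rewrite /GRing.add /= !(lquot_piD, lquot_piZ) scalerDr.
Qed.
Fact lquot_scaleDl (v : lquot) : {morph lquot_scale^~ v : a b / a + b}.
Proof.
move=> a b /=; elim/lquotW: v => x.
by rewrite [RHS]/GRing.add /= !(lquot_piD, lquot_piZ) scalerDl.
Qed.

HB.instance Definition _ := GRing.Zmodule_isLmodule.Build K lquot
  lquot_scaleA lquot_scale1 lquot_scaleDr lquot_scaleDl.

Lemma lquot_pi_linear a x y :
  lquot_pi (a *: x + y) = a *: lquot_pi x + lquot_pi y.
Proof.
by rewrite [RHS]/GRing.add /= [a *: lquot_pi x]lquot_piZ lquot_piD.
Qed.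

Fact lquot_lie_linearl a (u v w : lquot) :
  lquot_lie (a *: u + v) w = a *: lquot_lie u w + lquot_lie v w.
Proof.
elim/lquotW: u => x; elim/lquotW: v => y; elim/lquotW: w => z.
by rewrite -lquot_pi_linear !lquot_pi_lie -lquot_pi_linear lie_linearl.
Qed.
Fact lquot_lie_linearr a (u v w : lquot) :
  lquot_lie u (a *: v + w) = a *: lquot_lie u v + lquot_lie u w.
Proof.
elim/lquotW: u => x; elim/lquotW: v => y; elim/lquotW: w => z.
by rewrite -lquot_pi_linear !lquot_pi_lie -lquot_pi_linear lie_linearr.
Qed.
Fact lquot_liexx (u : lquot) : lquot_lie u u = 0.
Proof. by elim/lquotW: u => x; rewrite lquot_pi_lie liexx. Qed.
Fact lquot_jacobi (u v w : lquot) :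
  lquot_lie u (lquot_lie v w) + lquot_lie v (lquot_lie w u)
  + lquot_lie w (lquot_lie u v) = 0.
Proof.
elim/lquotW: u => x; elim/lquotW: v => y; elim/lquotW: w => z.
by rewrite /GRing.add /= !lquot_pi_lie !lquot_piD lie_jacobi.
Qed.

HB.instance Definition _ := Lmodule_isLieAlgebra.Build K lquot
  lquot_lie_linearl lquot_lie_linearr lquot_liexx lquot_jacobi.

Lemma lquot_pi_morphism : lie_morphism lquot_pi.
Proof. by split; [exact: lquot_pi_linear | move=> x y; rewrite -lquot_pi_lie]. Qed.

End LieQuotient.

(* The free Lie algebra on T: formal Lie expressions modulo the smallest
   congruence satisfying the axioms of Lie algebras. *)
Section FreeLie.
Variables (K : fieldType) (T : Type).

Inductive lterm : Type :=
| LGen of T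
| LZero
| LAdd of lterm & lterm
| LScale of K & lterm
| LLie of lterm & lterm.

HB.instance Definition _ := gen_eqMixin lterm.
HB.instance Definition _ := gen_choiceMixin lterm.

Inductive lterm_cong : lterm -> lterm -> Prop :=
| lc_refl s : lterm_cong s s
| lc_sym s t : lterm_cong s t -> lterm_cong t s
| lc_trans t s u : lterm_cong s t -> lterm_cong t u -> lterm_cong s u
| lc_add s s' t t' : lterm_cong s s' -> lterm_cong t t' ->
    lterm_cong (LAdd s t) (LAdd s' t')
| lc_scale a s s' : lterm_cong s s' -> lterm_cong (LScale a s) (LScale a s')
| lc_lie s s' t t' : lterm_cong s s' -> lterm_cong t t' ->
    lterm_cong (LLie s t) (LLie s' t')
| lc_addA s t u : lterm_cong (LAdd s (LAdd t u)) (LAdd (LAdd s t) u)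
| lc_addC s t : lterm_cong (LAdd s t) (LAdd t s)
| lc_add0 s : lterm_cong (LAdd LZero s) s
| lc_addN s : lterm_cong (LAdd (LScale (-1) s) s) LZero
| lc_scaleA a b s : lterm_cong (LScale a (LScale b s)) (LScale (a * b) s)
| lc_scale1 s : lterm_cong (LScale 1 s) s
| lc_scaleDr a s t :
    lterm_cong (LScale a (LAdd s t)) (LAdd (LScale a s) (LScale a t))
| lc_scaleDl a b s :
    lterm_cong (LScale (a + b) s) (LAdd (LScale a s) (LScale b s))
| lc_liel a s t u : lterm_cong (LLie (LAdd (LScale a s) t) u)
                               (LAdd (LScale a (LLie s u)) (LLie t u))
| lc_lier a s t u : lterm_cong (LLie s (LAdd (LScale a t) u))
                               (LAdd (LScale a (LLie s t)) (LLie s u))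
| lc_liexx s : lterm_cong (LLie s s) LZero
| lc_jacobi s t u :
    lterm_cong (LAdd (LAdd (LLie s (LLie t u)) (LLie t (LLie u s)))
                     (LLie u (LLie s t))) LZero.

Definition free_lie_eqv : rel lterm := fun s t => `[< lterm_cong s t >].

Lemma free_lie_eqv_refl : reflexive free_lie_eqv.
Proof. by move=> s; apply/asboolP; apply: lc_refl. Qed.

Lemma free_lie_eqv_sym : symmetric free_lie_eqv.
Proof. by move=> s t; apply/asboolP/asboolP => h; apply: lc_sym. Qed.

Lemma free_lie_eqv_trans : transitive free_lie_eqv.
Proof. by move=> t s u /asboolP h1 /asboolP h2; apply/asboolP; apply: (lc_trans h1). Qed.

Canonical free_lie_equiv :=
  EquivRel free_lie_eqv free_lie_eqv_refl free_lie_eqv_sym free_lie_eqv_trans.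

Definition free_lie := {eq_quot free_lie_eqv}.
HB.instance Definition _ := Choice.on free_lie.

Definition fl_pi (s : lterm) : free_lie := \pi_({eq_quot free_lie_eqv}) s.
Definition fl_repr (u : free_lie) : lterm := repr (u : {eq_quot free_lie_eqv}).

Lemma fl_piP s t : fl_pi s = fl_pi t <-> lterm_cong s t.
Proof.
split; first by move=> /eqmodP /asboolP.
by move=> h; apply/eqmodP/asboolP.
Qed.

Lemma fl_reprK u : fl_pi (fl_repr u) = u.
Proof. exact: reprK. Qed.

Lemma fl_pi_repr s : lterm_cong (fl_repr (fl_pi s)) s.
Proof. by apply/fl_piP; rewrite fl_reprK. Qed.

Lemma free_lieW (Pr : free_lie -> Prop) :
  (forall s, Pr (fl_pi s)) -> forall u, Pr u.
Proof. by move=> h u; rewrite -(fl_reprK u). Qed.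

Definition fl_add (u v : free_lie) := fl_pi (LAdd (fl_repr u) (fl_repr v)).
Definition fl_scale a (u : free_lie) := fl_pi (LScale a (fl_repr u)).
Definition fl_lie (u v : free_lie) := fl_pi (LLie (fl_repr u) (fl_repr v)).

Lemma fl_piD s t : fl_add (fl_pi s) (fl_pi t) = fl_pi (LAdd s t).
Proof. by apply/fl_piP; apply: lc_add; apply: fl_pi_repr. Qed.
Lemma fl_piZ a s : fl_scale a (fl_pi s) = fl_pi (LScale a s).
Proof. by apply/fl_piP; apply: lc_scale; apply: fl_pi_repr. Qed.
Lemma fl_pi_lie s t : fl_lie (fl_pi s) (fl_pi t) = fl_pi (LLie s t).
Proof. by apply/fl_piP; apply: lc_lie; apply: fl_pi_repr. Qed.

Fact fl_addA : associative fl_add.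
Proof.
elim/free_lieW=> s; elim/free_lieW=> t; elim/free_lieW=> u.
by rewrite !fl_piD; apply/fl_piP; apply: lc_addA.
Qed.
Fact fl_addC : commutative fl_add.
Proof.
elim/free_lieW=> s; elim/free_lieW=> t.
by rewrite !fl_piD; apply/fl_piP; apply: lc_addC.
Qed.
Fact fl_add0 : left_id (fl_pi LZero) fl_add.
Proof. by elim/free_lieW=> s; rewrite fl_piD; apply/fl_piP; apply: lc_add0. Qed.
Fact fl_addN : left_inverse (fl_pi LZero) (fl_scale (-1)) fl_add.
Proof. by elim/free_lieW=> s; rewrite fl_piZ fl_piD; apply/fl_piP; apply: lc_addN. Qed.

HB.instance Definition _ := GRing.isZmodule.Build free_lie
  fl_addA fl_addC fl_add0 fl_addN.

Fact fl_scaleA a b (v : free_lie) : fl_scale a (fl_scale b v) = fl_scale (a * b) v.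
Proof. by elim/free_lieW: v => s; rewrite !fl_piZ; apply/fl_piP; apply: lc_scaleA. Qed.
Fact fl_scale1 : left_id 1 fl_scale.
Proof. by elim/free_lieW=> s; rewrite !fl_piZ; apply/fl_piP; apply: lc_scale1. Qed.
Fact fl_scaleDr : right_distributive fl_scale +%R.
Proof.
move=> a; elim/free_lieW=> s; elim/free_lieW=> t.
by rewrite /GRing.add /= !(fl_piD, fl_piZ); apply/fl_piP; apply: lc_scaleDr.
Qed.
Fact fl_scaleDl (v : free_lie) : {morph fl_scale^~ v : a b / a + b}.
Proof.
move=> a b /=; elim/free_lieW: v => s.
by rewrite [RHS]/GRing.add /= !(fl_piD, fl_piZ); apply/fl_piP; apply: lc_scaleDl.
Qed.

HB.instance Definition _ := GRing.Zmodule_isLmodule.Build K free_lie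
  fl_scaleA fl_scale1 fl_scaleDr fl_scaleDl.

Lemma fl_pi_linear a s t : a *: fl_pi s + fl_pi t = fl_pi (LAdd (LScale a s) t).
Proof. by rewrite [LHS]/GRing.add /= [a *: fl_pi s]fl_piZ fl_piD. Qed.

Fact fl_lie_linearl a (u v w : free_lie) :
  fl_lie (a *: u + v) w = a *: fl_lie u w + fl_lie v w.
Proof.
elim/free_lieW: u => s; elim/free_lieW: v => t; elim/free_lieW: w => r.
by rewrite fl_pi_linear !fl_pi_lie fl_pi_linear; apply/fl_piP; apply: lc_liel.
Qed.
Fact fl_lie_linearr a (u v w : free_lie) :
  fl_lie u (a *: v + w) = a *: fl_lie u v + fl_lie u w.
Proof.
elim/free_lieW: u => s; elim/free_lieW: v => t; elim/free_lieW: w => r.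
by rewrite fl_pi_linear !fl_pi_lie fl_pi_linear; apply/fl_piP; apply: lc_lier.
Qed.
Fact fl_liexx (u : free_lie) : fl_lie u u = 0.
Proof. by elim/free_lieW: u => s; rewrite fl_pi_lie; apply/fl_piP; apply: lc_liexx. Qed.
Fact fl_jacobi (u v w : free_lie) :
  fl_lie u (fl_lie v w) + fl_lie v (fl_lie w u) + fl_lie w (fl_lie u v) = 0.
Proof.
elim/free_lieW: u => s; elim/free_lieW: v => t; elim/free_lieW: w => r.
by rewrite /GRing.add /= !fl_pi_lie !fl_piD; apply/fl_piP; apply: lc_jacobi.
Qed.

HB.instance Definition _ := Lmodule_isLieAlgebra.Build K free_lie
  fl_lie_linearl fl_lie_linearr fl_liexx fl_jacobi.

Definition free_gen (x : T) : free_lie := fl_pi (LGen x).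

Section UniversalProperty.
Variables (M : lieAlgType K) (g : T -> M).

Fixpoint lterm_eval (s : lterm) : M :=
  match s with
  | LGen x => g x
  | LZero => 0
  | LAdd s t => lterm_eval s + lterm_eval t
  | LScale a s => a *: lterm_eval s
  | LLie s t => lie (lterm_eval s) (lterm_eval t)
  end.

Lemma lterm_eval_cong s t : lterm_cong s t -> lterm_eval s = lterm_eval t.
Proof.
elim=> //= {s t}.
- by move=> t s u _ -> _ ->.
- by move=> s s' t t' _ -> _ ->.
- by move=> a s s' _ ->.
- by move=> s s' t t' _ -> _ ->.
- by move=> *; rewrite addrA.
- by move=> *; rewrite addrC.
- by move=> *; rewrite add0r.
- by move=> *; rewrite scaleN1r addNr.
- by move=> *; rewrite scalerA.
- by move=> *; rewrite scale1r.
- by move=> *; rewrite scalerDr.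
- by move=> *; rewrite scalerDl.
- by move=> *; rewrite lie_linearl.
- by move=> *; rewrite lie_linearr.
- by move=> *; rewrite liexx.
- by move=> *; rewrite lie_jacobi.
Qed.

Definition free_lift (u : free_lie) : M := lterm_eval (fl_repr u).

Lemma free_lift_pi s : free_lift (fl_pi s) = lterm_eval s.
Proof. by apply: lterm_eval_cong; apply: fl_pi_repr. Qed.

Lemma free_lift_gen x : free_lift (free_gen x) = g x.
Proof. by rewrite free_lift_pi. Qed.

Lemma free_lift_morphism : lie_morphism free_lift.
Proof.
split=> [a|]; elim/free_lieW=> s; elim/free_lieW=> t.
  by rewrite fl_pi_linear !free_lift_pi.
by rewrite [lie (fl_pi s) _]fl_pi_lie !free_lift_pi.
Qed.

Lemma free_lift_unique (f : free_lie -> M) :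
  lie_morphism f -> (forall x, f (free_gen x) = g x) -> f = free_lift.
Proof.
move=> [flin flie] fg; apply/funext; elim/free_lieW=> s; rewrite free_lift_pi.
have f0 : f 0 = 0.
  by apply: (@addrI _ (f 0)); have := flin 1 0 0; rewrite !scale1r !addr0 => <-.
elim: s => //= [s IHs t IHt|a s IHs|s IHs t IHt].
- have := flin 1 (fl_pi s) (fl_pi t); rewrite !scale1r IHs IHt => <-.
  by congr f; rewrite -fl_piD.
- have := flin a (fl_pi s) 0; rewrite f0 !addr0 IHs => <-.
  by congr f; rewrite -fl_piZ.
- by rewrite -IHs -IHt -flie; congr f; rewrite -fl_pi_lie.
Qed.

End UniversalProperty.
End FreeLie.

(* Algebras of formal series.  L is generated by the family g and graded by
   the length of brackets; a formal series of elements of L is a sequence whose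
   n-th term is homogeneous of degree n. *)
Section FormalSeries.
Variables (K : fieldType) (T : Type).

Inductive bracket_of (L : lieAlgType K) (g : T -> L) : nat -> L -> Prop :=
| bracket_gen x : bracket_of g 1 (g x)
| bracket_lie m n u v :
    bracket_of g m u -> bracket_of g n v -> bracket_of g (m + n) (lie u v).

Definition homog (L : lieAlgType K) (g : T -> L) (n : nat) : set L :=
  lspan [set x | bracket_of g n x].

Record formal_series (L : lieAlgType K) (g : T -> L) := FormalSeries {
  fs_part :> nat -> L;
  fs_homog : forall n, homog g n (fs_part n)
}.

Lemma formal_seriesP (L : lieAlgType K) (g : T -> L) (h k : formal_series g) :
  (forall n, h n = k n) -> h = k.
Proof.
case: h k => [h hP] [k kP] /= /funext hk; case: _ / hk in kP *.
by rewrite (Prop_irrelevance hP kP).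
Qed.

Lemma homog_map (L M : lieAlgType K) (f : L -> M) (g : T -> L) n x :
  lie_morphism f -> homog g n x -> homog (f \o g) n (f x).
Proof.
move=> [flin flie]; elim=> [|a u v hu _ IH].
  have -> : f 0 = 0; last by left.
  by apply: (@addrI _ (f 0)); have := flin 1 0 0; rewrite !scale1r !addr0 => <-.
rewrite flin; apply: lspan_incr => //=.
elim: hu => [y|p q y z _ hy _ hz]; first exact: (bracket_gen (f \o g)).
by rewrite flie; apply: bracket_lie.
Qed.

Definition fs_map (L M : lieAlgType K) (f : L -> M) (fM : lie_morphism f)
    (g : T -> L) (h : formal_series g) : formal_series (f \o g) :=
  FormalSeries (fun n => homog_map fM (fs_homog h n)).

End FormalSeries.

(* K<<T>>: noncommutative formal power series, i.e. families of coefficients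
   indexed by words; the completion of the universal enveloping algebra of the
   free Lie algebra on T. *)
Definition ncseries (K : fieldType) (T : eqType) : Type := seq T -> K.

Section NCSeries.
Variables (K : fieldType) (T : eqType).
Local Notation S := (ncseries K T).
Implicit Types (f g h : S) (w : seq T).

HB.instance Definition _ := GRing.Lmodule.copy S (seq T -> K^o).

Lemma ncsE : (forall f g w, (f + g) w = f w + g w) *
  (forall f w, (- f) w = - f w) * (forall (a : K) f w, (a *: f) w = a * f w) *
  (forall w, (0 : S) w = 0).
Proof. by []. Qed.

Definition ncs_one : S := fun w => (w == [::])%:R.

Definition ncs_mul f g : S :=
  fun w => \sum_(i < (size w).+1) f (take i w) * g (drop i w).

Definition ncs_shift (x : T) f : S := fun w => f (x :: w).

Lemma ncs_mul_nil f g : ncs_mul f g [::] = f [::] * g [::].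
Proof. by rewrite /ncs_mul big_ord_recl big_ord0 addr0. Qed.

Lemma ncs_mul_cons f g x w :
  ncs_mul f g (x :: w) = f [::] * g (x :: w) + ncs_mul (ncs_shift x f) g w.
Proof. by rewrite /ncs_mul /= big_ord_recl. Qed.

Fact ncs_mulDl : left_distributive ncs_mul +%R.
Proof.
move=> f g h; apply/funext => w; rewrite ncsE /ncs_mul -big_split.
by apply: eq_bigr => i _; rewrite ncsE mulrDl.
Qed.

Fact ncs_mulDr : right_distributive ncs_mul +%R.
Proof.
move=> f g h; apply/funext => w; rewrite ncsE /ncs_mul -big_split.
by apply: eq_bigr => i _; rewrite ncsE mulrDr.
Qed.

Fact ncs_scaleAl (a : K) f g : a *: ncs_mul f g = ncs_mul (a *: f) g.
Proof.
apply/funext => w; rewrite ncsE /ncs_mul mulr_sumr.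
by apply: eq_bigr => i _; rewrite ncsE mulrA.
Qed.

Fact ncs_scaleAr (a : K) f g : a *: ncs_mul f g = ncs_mul f (a *: g).
Proof.
apply/funext => w; rewrite ncsE /ncs_mul mulr_sumr.
by apply: eq_bigr => i _; rewrite ncsE mulrCA.
Qed.

Fact ncs_mulA : associative ncs_mul.
Proof.
move=> f g h; apply/funext => w.
elim: w f g h => [|x w IH] f g h; first by rewrite !ncs_mul_nil mulrA.
rewrite !ncs_mul_cons IH ncs_mul_nil.
have -> : ncs_shift x (ncs_mul f g) = f [::] *: ncs_shift x g + ncs_mul (ncs_shift x f) g.
  by apply/funext => v; rewrite /ncs_shift ncs_mul_cons.
by rewrite ncs_mulDl ncsE -ncs_scaleAl ncsE mulrDr mulrA addrA.
Qed.

Fact ncs_mul1l : left_id ncs_one ncs_mul.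
Proof.
move=> f; apply/funext => w; rewrite /ncs_mul big_ord_recl take0 drop0 /ncs_one.
rewrite eqxx mul1r big1 ?addr0 // => i _.
by rewrite -size_eq0 size_takel ?mul0r // /bump; case: i.
Qed.

Fact ncs_mul1r : right_id ncs_one ncs_mul.
Proof.
move=> f; apply/funext => w; rewrite /ncs_mul big_ord_recr /= take_size drop_size.
rewrite /ncs_one eqxx mulr1 big1 ?add0r // => i _.
by rewrite -size_eq0 size_drop subn_eq0 leqNgt ltn_ord mulr0.
Qed.

Fact ncs_oner_neq0 : ncs_one != 0.
Proof.
apply/eqP => /(congr1 (fun f : S => f [::])).
by rewrite ncsE /ncs_one eqxx => /eqP; rewrite oner_eq0.
Qed.

HB.instance Definition _ := GRing.Zmodule_isNzRing.Build S
  ncs_mulA ncs_mul1l ncs_mul1r ncs_mulDl ncs_mulDr ncs_oner_neq0.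
HB.instance Definition _ := GRing.Lmodule_isLalgebra.Build K S ncs_scaleAl.
HB.instance Definition _ := GRing.Lalgebra_isAlgebra.Build K S ncs_scaleAr.

Definition ncs_lie f g : S := f * g - g * f.

Fact ncs_lie_linearl (a : K) f g h :
  ncs_lie (a *: f + g) h = a *: ncs_lie f h + ncs_lie g h.
Proof.
by rewrite /ncs_lie mulrDl mulrDr -scalerAl -scalerAr scalerBr opprD addrACA.
Qed.
Fact ncs_lie_linearr (a : K) f g h :
  ncs_lie f (a *: g + h) = a *: ncs_lie f g + ncs_lie f h.
Proof.
by rewrite /ncs_lie mulrDl mulrDr -scalerAl -scalerAr scalerBr opprD addrACA.
Qed.
Fact ncs_liexx f : ncs_lie f f = 0.
Proof. exact: subrr. Qed.
Fact ncs_jacobi f g h :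
  ncs_lie f (ncs_lie g h) + ncs_lie g (ncs_lie h f) + ncs_lie h (ncs_lie f g) = 0.
Proof.
rewrite /ncs_lie !(mulrBl, mulrBr) !opprB !mulrA.
set a := f * g * h; set b := f * h * g; set c := g * h * f.
set d := h * g * f; set e := g * f * h; set k := h * f * g.
apply/funext => w; rewrite !ncsE; ring.
Qed.

HB.instance Definition _ := Lmodule_isLieAlgebra.Build K S
  ncs_lie_linearl ncs_lie_linearr ncs_liexx ncs_jacobi.

Definition ncs_gen (t : T) : S := fun w => (w == [:: t])%:R.

Lemma ncs_expr_small f n w : f [::] = 0 -> (size w < n)%N -> (f ^+ n) w = 0.
Proof.
move=> f0; elim: n w => // n IH w wn.
rewrite exprS /GRing.mul /= /ncs_mul big_ord_recl take0 f0 mul0r add0r.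
rewrite big1 // => -[i iw] _; rewrite IH ?mulr0 // size_drop.
by rewrite -ltnS; apply: leq_trans wn; rewrite ltnS ltn_subrL /= (leq_ltn_trans _ iw).
Qed.

(* exp f = \sum_n f^n / n! for f without constant term: by ncs_expr_small, only
   the powers n <= size w contribute to the coefficient of the word w. *)
Definition ncs_exp f : S :=
  fun w => \sum_(n < (size w).+1) (n`!%:R)^-1 * (f ^+ n) w.

(* log f = \sum_(n >= 1) (-1)^(n-1) (f - 1)^n / n for f with constant term 1. *)
Definition ncs_log f : S :=
  fun w => \sum_(1 <= n < (size w).+1) (-1) ^+ n.-1 / n%:R * ((f - 1) ^+ n) w.

Definition ncs_part (n : nat) f : S := fun w => if size w == n then f w else 0.

End NCSeries.

Section Bernoulli.
Variable K : fieldType.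

(* (\sum_n B_n / n! x^n) * (e^x - 1) = x as formal power series. *)
Definition is_bernoulli (B : nat -> K) : Prop :=
  forall n, \sum_(k < n.+1)
      (B k / k`!%:R) * (((n - k)`!%:R)^-1 - (n - k == 0)%N%:R) = (n == 1)%N%:R.

(* C_{mn} for m, n >= 1; the values at m = 0 or n = 0 are irrelevant. *)
Fixpoint ext_bernoulli (B : nat -> K) (m n : nat) : K :=
  match m with
  | 0 => 0
  | 1 => B n
  | m'.+1 => n%:R / n.+1%:R * ext_bernoulli B m' n.+1
      - n.+1%:R^-1 *
        \sum_(1 <= k < n.+1) 'C(n.+1, k)%:R * B k * ext_bernoulli B m' (n - k + 1)
  end.

End Bernoulli.

Section Hausdorff.
Variable K : fieldType.

(* The letters are booleans: P = false, Q = true. *)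
Definition freeL : lieAlgType K := LieAlgebra.clone K (free_lie K bool) _.
Definition genL : bool -> freeL := @free_gen K bool.
Definition metaL : lieAlgType K := LieAlgebra.clone K (lquot (derived2 freeL)) _.
Definition projL : freeL -> metaL := @lquot_pi K freeL (derived2 freeL).
Definition projL_morphism : lie_morphism projL := lquot_pi_morphism (derived2 freeL).
Definition genM : bool -> metaL := projL \o genL.

Definition freeL_hat : Type := formal_series genL.
Definition metaL_hat : Type := formal_series genM.
Definition projL_hat : freeL_hat -> metaL_hat := fs_map projL_morphism (g := genL).

(* The embedding of the free Lie algebra in its universal enveloping algebra. *)
Definition envelL (x : freeL) := free_lift (fun b : bool => ncs_gen K b) x.

Definition hausdorff_ncs :=
  ncs_log (ncs_exp (ncs_gen K false) * ncs_exp (ncs_gen K true)).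

Definition is_hausdorff (H : freeL_hat) : Prop :=
  forall n, envelL (H n) = ncs_part n hausdorff_ncs.

(* [Q^{n-1} P^{m-1} Q P] *)
Definition long_comm (L : lieAlgType K) (P Q : L) (m n : nat) : L :=
  iter n.-1 (lie Q) (iter m.-1 (lie P) (lie Q P)).

(* The homogeneous part of degree d of
   P + Q + \sum_(m, n >= 1) C_{mn} / (m! n!) [Q^{n-1} P^{m-1} Q P]. *)
Definition meta_hausdorff_part (B : nat -> K) (d : nat) : metaL :=
  let P := genM false in let Q := genM true in
  (if d == 1%N then P + Q else 0) +
  \sum_(1 <= m < d.+1) \sum_(1 <= n < d.+1 | (m + n == d)%N)
    (ext_bernoulli B m n / (m`!%:R * n`!%:R)) *: long_comm P Q m n.

Lemma long_comm_bracket (L : lieAlgType K) (g : bool -> L) m n :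
  (0 < m)%N -> (0 < n)%N ->
  bracket_of g (m + n) (long_comm (g false) (g true) m n).
Proof.
case: m => // m _; case: n => // n _; rewrite /long_comm /=.
elim: n => [|n IH] /=; last by rewrite addnS -add1n; apply: bracket_lie IH; left.
elim: m => [|m IH] /=; first by apply: (@bracket_lie _ _ _ _ 1 1); left.
by rewrite addSn -add1n; apply: bracket_lie IH; left.
Qed.

Fact meta_hausdorff_homog (B : nat -> K) d : homog genM d (meta_hausdorff_part B d).
Proof.
apply: lspanD.
  case: eqP => [->|_]; last by left.
  by apply: lspanD; apply: lspan_in; left.
rewrite big_nat; elim/big_ind: _ => [|x y|m /andP[m0 _]]; first by left.
  exact: lspanD.
rewrite big_nat_cond; elim/big_ind: _ => [|x y|n /andP[/andP[n0 _] /eqP <-]].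
- by left.
- exact: lspanD.
- by apply: lspanZ; apply: lspan_in; apply: long_comm_bracket.
Qed.

Definition meta_hausdorff (B : nat -> K) : metaL_hat :=
  FormalSeries (meta_hausdorff_homog B).

End Hausdorff.

(* Main.v *)
Require Import Defs.
From mathcomp Require Import all_boot all_order all_algebra.
From mathcomp Require Import ring boolp reals complex.

(* Write h = log (e^P e^Q) and let d = E + ad Q, where E multiplies words by
   their length.  This derivation satisfies d (e^h) = (P + Q) e^h, that is,
   sum_k (ad h)^k (d h) / (k + 1)! = P + Q, which expresses the part of degree
   n of h by brackets of its parts of lower degree: h is a Lie series.  It has
   a unique preimage in the completed free Lie algebra, because u, homogeneous
   of degree n, is recovered from its image by [x_1 ... x_n] <- x_1 ... x_n,
   which gives n u.

   In degree >= 2, the class of u in the free metabelian Lie algebra is read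
   off the image in C[[p, q]] of the Fox derivative d_P u, where
   u = (d_P u) P + (d_Q u) Q: ad P and ad Q commute on the derived algebra, and
   d_P [Q^(n-1) P^(m-1) Q P] is p^(m-1) q^n.  With beta(x) = x / (e^x - 1), the
   Fox derivative of e^h gives d_P h = beta(p + q) (e^p - 1) / p in C[[p, q]];
   comparing coefficients, this is C_mn = sum_(i < m) 'C(m, i) B_(n + i).  The
   recursion of the C_mn follows from the identity
   (beta + x) (1 + D)^m beta = beta D^m (beta + x), with D = d/dx, obtained by
   applying D^m to beta + x = e^x beta. *)

Set Implicit Arguments.
Unset Strict Implicit.
Unset Printing Implicit Defensive.

Import Order.TTheory GRing.Theory Num.Theory.
Local Open Scope ring_scope.

(** * Extended Bernoulli numbers *)

Section BinomialConvolution.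
Variable K : comNzRingType.
Implicit Types (a b c : nat -> K) (n : nat).

Definition seq_shift a : nat -> K := fun n => a n.+1.

(* The product of exponential generating functions; the recursion is the
   Leibniz rule, the shift being the derivative. *)
Fixpoint binom_conv a b n : K :=
  if n is n'.+1 then binom_conv (seq_shift a) b n' + binom_conv a (seq_shift b) n'
  else a 0 * b 0.

Lemma binom_convE a b n :
  binom_conv a b n = \sum_(k < n.+1) 'C(n, k)%:R * a k * b (n - k)%N.
Proof.
elim: n a b => [|n IH] a b /=; first by rewrite big_ord1 bin0 mul1r.
rewrite !IH [in RHS]big_ord_recl [in RHS]/= /bump.
under [in RHS]eq_bigr => k _ do rewrite add1n binS natrD subSS 2!mulrDl.
rewrite big_split /= addrA addrC; congr (_ + _).
rewrite big_ord_recl [in RHS]big_ord_recr /= !bin0 bin_small // !mul0r addr0.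
rewrite /seq_shift subn0; congr (_ + _); apply: eq_bigr => k _.
by rewrite /bump add1n subnSK.
Qed.

Lemma eq_binom_conv a a' b b' n :
  a =1 a' -> b =1 b' -> binom_conv a b n = binom_conv a' b' n.
Proof.
by move=> ea eb; rewrite !binom_convE; apply: eq_bigr => k _; rewrite ea eb.
Qed.

Lemma binom_convDl a a' b n :
  binom_conv (fun k => a k + a' k) b n = binom_conv a b n + binom_conv a' b n.
Proof.
by rewrite !binom_convE -big_split; apply: eq_bigr => k _; rewrite mulrDr mulrDl.
Qed.

Lemma binom_convDr a b b' n :
  binom_conv a (fun k => b k + b' k) n = binom_conv a b n + binom_conv a b' n.
Proof.
by rewrite !binom_convE -big_split; apply: eq_bigr => k _; rewrite mulrDr.
Qed.

Lemma binom_convC a b n : binom_conv a b n = binom_conv b a n.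
Proof.
by elim: n a b => [|n IH] a b /=; rewrite 1?mulrC // IH addrC IH.
Qed.

Lemma binom_convA a b c n :
  binom_conv a (binom_conv b c) n = binom_conv (binom_conv a b) c n.
Proof.
elim: n a b c => [|n IH] a b c /=; first by rewrite mulrA.
rewrite (@binom_convDr a (binom_conv (seq_shift b) c) (binom_conv b (seq_shift c))).
rewrite (@binom_convDl (binom_conv (seq_shift a) b) (binom_conv a (seq_shift b)) c).
by rewrite !IH addrA.
Qed.

End BinomialConvolution.

Section ExtendedBernoulli.
Variables (K : numFieldType) (B : nat -> K).
Hypothesis hB : is_bernoulli B.

(** The defining relation divided by x: beta(x) times (e^x - 1)/x is 1. The top term drops out
    because e^x - 1 has no constant term. *)
Lemma bernoulli_inv n :
  \sum_(k < n.+1) B k / k`!%:R * ((n.+1 - k)`!%:R)^-1 = (n == 0)%:R.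
Proof.
have := hB n.+1; rewrite big_ord_recr /= subnn fact0 invr1 subrr mulr0 addr0.
rewrite eqSS => <-; apply: eq_bigr => k _.
by rewrite subSn -1?ltnS //= subr0.
Qed.

Lemma factr_neq0 n : n`!%:R != 0 :> K.
Proof. by rewrite pnatr_eq0 -lt0n fact_gt0. Qed.

Lemma binr_fact n k : (k <= n)%N ->
  'C(n, k)%:R = n`!%:R / k`!%:R / (n - k)`!%:R :> K.
Proof.
move=> kn; rewrite -(bin_fact kn) !natrM.
by rewrite -mulrA -invfM mulfK // mulf_neq0 // factr_neq0.
Qed.

Lemma bernoulli_sum n : \sum_(k < n) 'C(n, k)%:R * B k = (n == 1)%:R.
Proof.
case: n => [|n]; first by rewrite big_ord0.
rewrite eqSS; transitivity ((n.+1)`!%:R * (n == 0)%:R : K); last first.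
  by case: n => [|n]; rewrite ?mulr1 ?mulr0.
rewrite -(bernoulli_inv n) mulr_sumr; apply: eq_bigr => k _.
rewrite binr_fact; last by rewrite ltnW.
by rewrite -!mulrA; congr (_ * _); rewrite mulrA mulrC mulrA.
Qed.

(* The coefficients of (1 + D)^m beta as an exponential generating function,
   with beta(q) = q / (e^q - 1) and D = d/dq. *)
Fixpoint bernoulli_tr (m n : nat) : K :=
  if m is m'.+1 then bernoulli_tr m' n + bernoulli_tr m' n.+1 else B n.

Lemma bernoulli_trE m n :
  bernoulli_tr m n = \sum_(i < m.+1) 'C(m, i)%:R * B (n + i)%N.
Proof.
elim: m n => [|m IH] n /=; first by rewrite big_ord1 bin0 mul1r addn0.
rewrite !IH [in RHS]big_ord_recl [in RHS]/= /bump.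
under [in RHS]eq_bigr => k _ do rewrite add1n binS natrD mulrDl.
rewrite big_split /= addrA; congr (_ + _).
  rewrite big_ord_recl [in RHS]big_ord_recr /= !bin0 bin_small // !mul0r addr0.
  by congr (_ + _).
by apply: eq_bigr => k _; rewrite addSnnS.
Qed.

(** The closed form of C_mn, recognized in the variable n as ((1 + D)^m - D^m) beta; the recursion
    is verified in this shape. *)
Lemma bernoulli_tr_sub m n :
  bernoulli_tr m n - B (n + m)%N = \sum_(i < m) 'C(m, i)%:R * B (n + i)%N.
Proof. by rewrite bernoulli_trE big_ord_recr /= binn mul1r addrK. Qed.

(** Its exponential generating function is the variable itself. *)
Let q (n : nat) : K := (n == 1)%:R.

Lemma exp_bernoulli n : binom_conv (fun=> 1) B n = B n + q n.
Proof.
rewrite binom_convC binom_convE big_ord_recr /= binn mul1r mulr1 addrC.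
by under eq_bigr do rewrite mulr1; rewrite bernoulli_sum.
Qed.

(** D^m (e^x beta) = e^x (1 + D)^m beta, while e^x beta = beta + x. *)
Lemma exp_bernoulli_tr m n :
  binom_conv (fun=> 1) (bernoulli_tr m) n = B (n + m)%N + q (n + m)%N.
Proof.
elim: m n => [|m IH] n; first by rewrite addn0 exp_bernoulli.
by rewrite addnS -addSn -IH /= binom_convDr.
Qed.

(* beta D^m (beta + q) = beta D^m (e^q beta) = beta e^q (1 + D)^m beta
   = (beta + q) (1 + D)^m beta. *)
Lemma bernoulli_tr_conv m n :
  binom_conv B (fun n => B (n + m)%N + q (n + m)%N) n =
  binom_conv B (bernoulli_tr m) n + binom_conv q (bernoulli_tr m) n.
Proof.
rewrite -binom_convDl.
transitivity (binom_conv B (binom_conv (fun=> 1) (bernoulli_tr m)) n).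
  by apply: eq_binom_conv => // k; rewrite exp_bernoulli_tr.
rewrite binom_convA; apply: eq_binom_conv => // k.
by rewrite binom_convC exp_bernoulli.
Qed.

Lemma conv_q (a : nat -> K) n : binom_conv q a n.+1 = n.+1%:R * a n.
Proof.
rewrite binom_convE big_ord_recl /= mulr0 mul0r add0r big_ord_recl /= bin1 mulr1.
rewrite subSS subn0 big1 ?addr0 // => i _.
by rewrite /q /bump /= mulr0 mul0r.
Qed.

(** Induction on m, for all n. Up to two boundary terms, the sum in the recursion is the product of
    beta with ((1 + D)^m - D^m) beta, which [bernoulli_tr_conv] evaluates. *)
Lemma ext_bernoulliE m n : (0 < m)%N -> (0 < n)%N ->
  ext_bernoulli B m n = \sum_(i < m) 'C(m, i)%:R * B (n + i)%N.
Proof.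
case: m => // m _; elim: m n => [|m IH] n n0.
  by rewrite big_ord1 bin0 mul1r addn0.
rewrite -bernoulli_tr_sub.
have -> : ext_bernoulli B m.+2 n = n%:R / n.+1%:R * ext_bernoulli B m.+1 n.+1
    - n.+1%:R^-1 * \sum_(1 <= k < n.+1)
        'C(n.+1, k)%:R * B k * ext_bernoulli B m.+1 (n - k + 1) by [].
rewrite IH // -bernoulli_tr_sub.
set M := m.+1; pose d k := bernoulli_tr M k - B (k + M)%N.
have d0 : d 0 = (M == 1)%:R.
  by rewrite /d bernoulli_tr_sub; under eq_bigr do rewrite add0n; exact: bernoulli_sum.
(* This is [bernoulli_tr_conv] with beta D^M beta subtracted. Since M > 0, D^M x is the constant
   [M = 1]. *)
have dconv : binom_conv B d n.+1 = B n.+1 * (M == 1)%:R - n.+1%:R * bernoulli_tr M n.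
  have -> : B n.+1 * (M == 1)%:R = binom_conv B (fun k => q (k + M)%N) n.+1.
    rewrite binom_convE big_ord_recr /= binn mul1r subnn add0n big1 ?add0r // => k _.
    by rewrite /q subSn -1?ltnS //= addSn addnS eqSS mulr0.
  apply/(canRL (addrK _)); rewrite -conv_q.
  apply: (addrI (binom_conv B (fun k => B (k + M)%N) n.+1)).
  rewrite -binom_convDr bernoulli_tr_conv addrA -binom_convDr; congr (_ + _).
  by apply: eq_binom_conv => // k; rewrite addrC subrK.
set S := \sum_(1 <= k < n.+1) _.
(* The terms k = 0 and k = n + 1 of the convolution lie outside [S]: they are d_(n+1), as B_0 = 1,
   and B_(n+1) d_0. *)
have eS : binom_conv B d n.+1 = d n.+1 + S + B n.+1 * (M == 1)%:R.
  rewrite binom_convE big_ord_recr big_ord_recl /= binn bin0 subnn subn0 d0 !mul1r.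
  have -> : B 0 = 1 by have := bernoulli_sum 1; rewrite big_ord1 bin0 mul1r.
  rewrite mul1r; congr (_ + _ + _).
  rewrite /S big_add1 big_mkord; apply: eq_bigr => k _.
  rewrite IH; last by rewrite addn1.
  rewrite /bump /= add1n subSS.
  by rewrite -bernoulli_tr_sub addn1 subnSK.
have n1 : n.+1%:R != 0 :> K by rewrite pnatr_eq0.
have {eS dconv} -> : S = - (d n.+1 + n.+1%:R * bernoulli_tr M n).
  have := eS; rewrite dconv => /(canLR (addrK _)) e.
  by rewrite -[S](addKr (d n.+1)) -e /=; ring.
rewrite /d addnS -addSn /=.
move: n1; rewrite -natr1 => n1; field; exact: n1.
Qed.

End ExtendedBernoulli.

(** * Noncommutative power series *)

Section NCSeriesTheory.
Variables (K : fieldType) (T : eqType).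
Local Notation S := (ncseries K T).
Implicit Types (f g h : S) (w : seq T) (x : T) (p q : {poly K}).

Lemma ncs_mulE f g w :
  (f * g) w = \sum_(i < (size w).+1) f (take i w) * g (drop i w).
Proof. by []. Qed.

Lemma ncs_sumE I (r : seq I) (P : pred I) (F : I -> S) w :
  (\sum_(i <- r | P i) F i) w = \sum_(i <- r | P i) F i w.
Proof. by elim/big_rec2: _ => // i a b _ <-. Qed.

Lemma ncs1E w : (1 : S) w = (w == [::])%:R.
Proof. by []. Qed.

(** Congruence modulo degree > N, under which infinite series may be replaced by finite sums. *)
Definition ncs_eq N f g := forall w, (size w <= N)%N -> f w = g w.

Lemma ncs_eq_sym N f g : ncs_eq N f g -> ncs_eq N g f.
Proof. by move=> fg w wN; rewrite fg. Qed.

Lemma ncs_eq_trans N f g h : ncs_eq N f g -> ncs_eq N g h -> ncs_eq N f h.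
Proof. by move=> fg gh w wN; rewrite fg // gh. Qed.

Lemma ncs_eqD N f f' g g' : ncs_eq N f f' -> ncs_eq N g g' -> ncs_eq N (f + g) (f' + g').
Proof. by move=> ff gg w wN; rewrite !ncsE ff // gg. Qed.

Lemma ncs_eqN N f f' : ncs_eq N f f' -> ncs_eq N (- f) (- f').
Proof. by move=> ff w wN; rewrite !ncsE ff. Qed.

Lemma ncs_eqM N f f' g g' : ncs_eq N f f' -> ncs_eq N g g' -> ncs_eq N (f * g) (f' * g').
Proof.
move=> ff gg w wN; rewrite !ncs_mulE; apply: eq_bigr => -[i /= iw] _.
rewrite ff ?gg ?size_drop ?size_takel //.
  exact: leq_trans (leq_subr _ _) wN.
exact: leq_trans wN.
Qed.

Lemma ncs_eq_sum N n (F G : 'I_n -> S) :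
  (forall i, ncs_eq N (F i) (G i)) -> ncs_eq N (\sum_(i < n) F i) (\sum_(i < n) G i).
Proof. by move=> FG w wN; rewrite !ncs_sumE; apply: eq_bigr => i _; apply: FG. Qed.

Definition ncs_val m f := forall w, (size w < m)%N -> f w = 0.

Lemma ncs_val1 f : f [::] = 0 -> ncs_val 1 f.
Proof. by move=> f0 [] // x w; rewrite ltnS. Qed.

Lemma ncs_valM m n f g : ncs_val m f -> ncs_val n g -> ncs_val (m + n) (f * g).
Proof.
move=> fm gn w wmn; rewrite ncs_mulE big1 // => -[i /= iw] _.
have [im|mi] := ltnP i m; first by rewrite fm ?mul0r // size_takel.
rewrite gn ?mulr0 // size_drop ltn_subLR //.
by apply: leq_trans wmn _; rewrite leq_add2r.
Qed.

Lemma ncs_valX n f : f [::] = 0 -> ncs_val n (f ^+ n).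
Proof. by move=> f0 w wn; rewrite ncs_expr_small. Qed.

Lemma ncs_valB m f g : ncs_val m f -> ncs_val m g -> ncs_val m (f - g).
Proof. by move=> fm gm w wm; rewrite !ncsE fm // gm // subr0. Qed.

Lemma ncs_val_eq0 N m f : (N < m)%N -> ncs_val m f -> ncs_eq N f 0.
Proof. by move=> Nm fm w wN; rewrite fm // (leq_ltn_trans wN). Qed.

(** Induction on the length of v: its coefficient in (f - g) h is that in f - g, plus terms with
    proper prefixes of v, which vanish already. *)
Lemma ncs_mulIeq N f g h : h [::] = 1 -> ncs_eq N (f * h) (g * h) -> ncs_eq N f g.
Proof.
move=> h1 fgh; suff: forall w, (size w <= N)%N -> (f - g) w = 0.
  by move=> fg w wN; apply/eqP; rewrite -subr_eq0; apply/eqP; exact: fg.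
have {}fgh w : (size w <= N)%N -> ((f - g) * h) w = 0.
  by move=> wN; rewrite mulrBl !ncsE fgh // subrr.
move: (f - g) fgh => {f g}f fh w; elim/last_ind: w {-2}w (leqnn (size w)) => [|w y IH] v.
  rewrite leqn0 size_eq0 => /eqP -> N0.
  by have := fh [::] N0; rewrite ncs_mulE big_ord1 h1 mulr1.
move=> vw vN; have := fh v vN.
rewrite ncs_mulE big_ord_recr /= take_size drop_size h1 mulr1.
rewrite big1 ?add0r // => -[i /= iv] _; have iv' := ltnW iv.
rewrite IH ?mul0r ?size_takel //; last exact: leq_trans iv' vN.
by rewrite -ltnS; apply: leq_trans iv _; rewrite -(size_rcons w y).
Qed.

Lemma horner_alg_comp p q f : horner_alg f (p \Po q) = horner_alg (horner_alg f q) p.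
Proof.
elim/poly_ind: p => [|p c IH]; first by rewrite comp_poly0 !raddf0.
by rewrite comp_poly_MXaddC !rmorphD !rmorphM /= IH !horner_algC horner_algX.
Qed.

Lemma horner_algXn n f : horner_alg f 'X^n = f ^+ n.
Proof. by rewrite rmorphXn /= horner_algX. Qed.

Lemma horner_alg_poly n (c : nat -> K) f :
  horner_alg f (\poly_(i < n) c i) = \sum_(i < n) c i *: f ^+ i.
Proof.
rewrite poly_def raddf_sum; apply: eq_bigr => i _.
by rewrite /= -mul_polyC rmorphM /= horner_algC mulr_algl horner_algXn.
Qed.

(** p - q is a multiple of X^(N+1), and f^(N+1) vanishes on words of length at most N. *)
Lemma horner_alg_eq N p q f : f [::] = 0 -> (forall i, (i <= N)%N -> p`_i = q`_i) ->
  ncs_eq N (horner_alg f p) (horner_alg f q).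
Proof.
move=> f0 pq; have -> : p = q + drop_poly N.+1 (p - q) * 'X^(N.+1).
  rewrite -[LHS](subrK q) addrC; congr (_ + _).
  rewrite -{1}[p - q](poly_take_drop N.+1) -[RHS]add0r; congr (_ + _).
  apply/polyP => i; rewrite coef_take_poly coef0 ltnS.
  by case: leqP => // iN; rewrite coefB pq ?subrr.
rewrite rmorphD rmorphM /= horner_algXn -[X in ncs_eq N _ X]addr0; apply: ncs_eqD => //.
apply: (@ncs_val_eq0 N (0 + N.+1)) => //; apply: ncs_valM => //.
exact: ncs_valX.
Qed.

Lemma horner_alg_eqr N p f g : ncs_eq N f g -> ncs_eq N (horner_alg f p) (horner_alg g p).
Proof.
move=> fg; elim/poly_ind: p => [|p c IH]; first by rewrite !raddf0.
rewrite !rmorphD !rmorphM /= !horner_algX !horner_algC; apply: ncs_eqD => //.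
exact: ncs_eqM.
Qed.

End NCSeriesTheory.

(** * The exponential inverts the logarithm *)

Section ExpLog.
Variables (K : numFieldType) (T : eqType).
Local Notation S := (ncseries K T).
Implicit Types (f g h : S) (w : seq T) (x : T).

Definition exp_poly N : {poly K} := \poly_(i < N.+1) (i`!%:R)^-1.
(** At i = 0 the coefficient is 1 / 0 = 0, so there is no constant term. *)
Definition log_poly N : {poly K} := \poly_(i < N.+1) ((-1) ^+ i.-1 / i%:R).

Lemma ncs_exp_poly N f : f [::] = 0 -> ncs_eq N (ncs_exp f) (horner_alg f (exp_poly N)).
Proof.
move=> f0 w wN; rewrite horner_alg_poly ncs_sumE /ncs_exp.
rewrite -!(big_mkord xpredT (fun i => (i`!%:R)^-1 * (f ^+ i) w)).
rewrite [RHS](big_cat_nat (n := (size w).+1)) //=.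
rewrite [X in _ = _ + X]big_nat [X in _ = _ + X]big1 ?addr0 // => i /andP[wi _].
by rewrite ncs_expr_small ?mulr0.
Qed.

Lemma ncs_log_poly N f : f [::] = 1 ->
  ncs_eq N (ncs_log f) (horner_alg (f - 1) (log_poly N)).
Proof.
move=> f1 w wN; rewrite horner_alg_poly ncs_sumE /ncs_log.
have f0 : (f - 1) [::] = 0 by rewrite !ncsE f1 ncs1E eqxx subrr.
rewrite -(big_mkord xpredT (fun i => (-1) ^+ i.-1 / i%:R * ((f - 1) ^+ i) w)).
rewrite [RHS](big_cat_nat (n := (size w).+1)) //=.
rewrite [X in _ = _ + X]big_nat [X in _ = _ + X]big1 ?addr0 => [|i /andP[wi _]].
  by rewrite [RHS]big_ltn // invr0 mulr0 mul0r add0r.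
by rewrite ncs_expr_small ?mulr0.
Qed.

Lemma deriv_exp_poly N : (exp_poly N)^`() = exp_poly N - (N`!%:R)^-1 *: 'X^N.
Proof.
apply/polyP => i; rewrite coef_deriv coefB coefZ coefXn !coef_poly !ltnS.
case: (ltngtP i N) => [iN|iN|->]; rewrite ?mulr0 ?mulr1 ?subr0 ?mul0rn ?subrr //.
by rewrite factS natrM invfM -[LHS]mulr_natr mulrAC mulVf ?mul1r // pnatr_eq0.
Qed.

Lemma deriv_log_poly N : (1 + 'X) * (log_poly N)^`() = 1 - (- 'X) ^+ N.
Proof.
have -> : (log_poly N)^`() = \sum_(i < N) (- 'X) ^+ i.
  rewrite /log_poly poly_def raddf_sum big_ord_recl /=.
  rewrite expr0 invr0 mulr0 scale0r deriv0 add0r.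
  apply: eq_bigr => i _; rewrite /bump /= add1n derivZ derivXn /= -scaler_nat scalerA.
  rewrite mulfVK ?pnatr_eq0 // [in RHS]exprNn -signr_odd -[in RHS]signr_odd.
  by case: odd; rewrite ?expr1 ?scaleN1r ?mulN1r ?expr0 ?scale1r ?mul1r.
rewrite -[RHS]opprB subrX1 -mulNr; congr (_ * _).
by rewrite opprB opprK addrC.
Qed.

(* As polynomials modulo X^(N+1): v = exp (log (1 + X)) satisfies (1 + X) v' = v. *)
Lemma exp_log_poly N i : (i <= N)%N -> (exp_poly N \Po log_poly N)`_i = (1 + 'X)`_i.
Proof.
set v := _ \Po _.
have [r lr] : exists r, log_poly N = r * 'X.
  exists (drop_poly 1 (log_poly N)); rewrite -[LHS](poly_take_drop 1).
  rewrite -[RHS]add0r expr1; congr (_ + _).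
  apply/polyP => -[|j]; rewrite coef_take_poly coef0 //=.
  by rewrite coef_poly invr0 mulr0.
(* Two truncation errors arise, from the derivatives of exp and of log. Both are multiples of X^N,
   the first because X divides [log_poly N]. *)
have [s dv] : exists s, (1 + 'X) * v^`() = v + s * 'X^N.
  rewrite deriv_comp deriv_exp_poly mulrCA deriv_log_poly linearB linearZ /= -/v.
  rewrite comp_Xn_poly lr exprMn.
  rewrite exprNn; set c := _^-1.
  exists (- v * (-1) ^+ N - (c *: r ^+ N) * (1 - (-1) ^+ N * 'X^N)).
  rewrite scalerAl.
  move: (c *: _ : {poly K}) (v) ((-1) ^+ N : {poly K}) ('X^N : {poly K}).
  by move=> t v' e x; ring.
(* Thus (j + 1) v_(j+1) = (1 - j) v_j, and v_0 = 1 forces the coefficients 1, 1, 0, 0, ... *)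
have dvi j : (j < N)%N -> v`_j.+1 *+ j.+1 = v`_j - v`_j *+ j.
  move=> jN; have := congr1 (fun p : {poly K} => p`_j) dv.
  rewrite mulrDl mul1r !coefD coefMXn jN addr0 coefXM coef_deriv => /(canRL (addrK _)) ->.
  by case: j {jN} => [|j] /=; rewrite ?coef_deriv // mulr0n.
have v0 : v`_0 = 1.
  rewrite -horner_coef0 horner_comp [in X in _.[X]]lr !hornerE.
  by rewrite horner_coef0 coef_poly invr1.
have Xi j : (1 + 'X : {poly K})`_j = (j <= 1)%:R.
  by rewrite coefD coef1 coefX; case: j => [|[|j]]; rewrite ?addr0 ?add0r.
rewrite Xi; move: (v : seq K) v0 dvi => u u0 dui.
elim: i => [|i IH] iN; first by rewrite u0.
have i1 : i.+1%:R != 0 :> K by rewrite pnatr_eq0.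
apply: (mulIf i1); rewrite mulr_natr dui // (IH (ltnW iN)).
case: i {IH iN i1} => [|[|i]]; first by rewrite mulr0n subr0 mulr1.
  by rewrite subrr mul0r.
by rewrite mul0rn subr0 mul0r.
Qed.

(** On a given word both series are polynomials in the single element g - 1, so the commutative
    identity [exp_log_poly] applies. *)
Lemma ncs_logK g : g [::] = 1 -> ncs_exp (ncs_log g) = g.
Proof.
move=> g1; apply/funext => w; set N := size w.
have f0 : (g - 1) [::] = 0 by rewrite !ncsE g1 ncs1E eqxx subrr.
have h0 : ncs_log g [::] = 0 by rewrite /ncs_log big_geq.
rewrite (ncs_exp_poly h0 (leqnn N)).
rewrite (horner_alg_eqr _ (ncs_log_poly g1) (leqnn N)) -horner_alg_comp.
rewrite (horner_alg_eq f0 (@exp_log_poly N) (leqnn N)).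
by rewrite rmorphD rmorph1 /= horner_algX addrC subrK.
Qed.

End ExpLog.

(** * The exponential and derivations *)

(** With a_k = (ad h)^k (d h), the rule h a_k = a_(k+1) + a_k h moves all powers of h to the right,
    and Pascal's rule collects the coefficients. *)
Lemma derivation_expr (R : nzRingType) (d : R -> R) (h : R) n :
  d 1 = 0 -> (forall f g, d (f * g) = d f * g + f * d g) ->
  d (h ^+ n) = \sum_(k < n)
    (iter k (fun z => h * z - z * h) (d h) * h ^+ (n - k.+1)) *+ 'C(n, k.+1).
Proof.
move=> d1 dM; elim: n => [|n IH]; first by rewrite big_ord0 expr0.
rewrite exprS dM IH; pose a k := iter k (fun z => h * z - z * h) (d h).
transitivity (\sum_(k < n.+1) (a k * h ^+ (n - k)) *+ ('C(n, k.+1) + 'C(n, k)));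
  last first.
  by apply: eq_bigr => k _; rewrite subSS binS.
under [RHS]eq_bigr => k _ do rewrite mulrnDr.
rewrite big_split /= [X in _ = X + _]big_ord_recr [X in _ = _ + X]big_ord_recl /=.
rewrite bin_small // mulr0n addr0 bin0 subn0 mulr1n addrCA; congr (_ + _).
rewrite mulr_sumr -big_split; apply: eq_bigr => k _ /=.
rewrite mulrnAr -mulrnDl; congr (_ *+ _).
rewrite /bump /= add0n -(subnSK (ltn_ord k)) exprS mulrBl addrC.
by rewrite !mulrA subrK.
Qed.

Section Derivation.
Variables (K : fieldType) (T : eqType).
Local Notation S := (ncseries K T).
Implicit Types (f g h y : S) (w : seq T) (x : T).

Definition ncs_euler f : S := fun w => (size w)%:R * f w.

Lemma ncs_eulerM f g : ncs_euler (f * g) = ncs_euler f * g + f * ncs_euler g.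
Proof.
apply/funext => w; rewrite ncsE [LHS]/ncs_euler !ncs_mulE mulr_sumr -big_split.
apply: eq_bigr => -[i /= iw] _; rewrite /ncs_euler size_takel // size_drop.
by rewrite -{1}(subnKC (_ : i <= size w)%N) // natrD; ring.
Qed.

Definition ncs_delta y f : S := ncs_euler f + lie y f.

Lemma ncs_delta_linear y a f g :
  ncs_delta y (a *: f + g) = a *: ncs_delta y f + ncs_delta y g.
Proof.
rewrite /ncs_delta lie_linearr; apply/funext => w; rewrite !ncsE /ncs_euler !ncsE; ring.
Qed.

Lemma ncs_deltaM y f g : ncs_delta y (f * g) = ncs_delta y f * g + f * ncs_delta y g.
Proof.
rewrite /ncs_delta ncs_eulerM /lie /= /ncs_lie mulrDl mulrDr [RHS]addrACA; congr (_ + _).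
by rewrite mulrBl mulrBr !mulrA subrKA.
Qed.

Lemma ncs_delta1 y : ncs_delta y 1 = 0.
Proof.
rewrite /ncs_delta /lie /= /ncs_lie mulr1 mul1r subrr addr0; apply/funext => -[|x w].
  by rewrite /ncs_euler mul0r.
by rewrite /ncs_euler ncs1E mulr0.
Qed.

Lemma ncs_deltaZ y a f : ncs_delta y (a *: f) = a *: ncs_delta y f.
Proof.
rewrite /ncs_delta lieZr; apply/funext => w; rewrite !ncsE /ncs_euler !ncsE; ring.
Qed.

Lemma ncs_delta_sum y n (F : 'I_n -> S) :
  ncs_delta y (\sum_(i < n) F i) = \sum_(i < n) ncs_delta y (F i).
Proof.
elim: n F => [|n IH] F.
  by rewrite !big_ord0; have := ncs_deltaZ y 0 0; rewrite !scale0r.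
by rewrite !big_ord_recl -IH -{1}(scale1r (F _)) ncs_delta_linear scale1r.
Qed.

Lemma ncs_delta_eq N y f g : ncs_eq N f g -> ncs_eq N (ncs_delta y f) (ncs_delta y g).
Proof.
move=> fg; apply: ncs_eqD; first by move=> w wN; rewrite /ncs_euler fg.
by apply: ncs_eqD; [|apply: ncs_eqN]; apply: ncs_eqM.
Qed.

Lemma ncs_val_ad k f g : f [::] = 0 -> g [::] = 0 -> ncs_val k.+1 (iter k (lie f) g).
Proof.
move=> f0 g0; elim: k => [|k IH]; first exact: ncs_val1.
apply: ncs_valB; first exact: (ncs_valM (ncs_val1 f0) IH).
by rewrite -addn1; exact: (ncs_valM IH (ncs_val1 f0)).
Qed.
End Derivation.

Section ExpDerivation.
Variables (K : numFieldType) (T : eqType).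
Local Notation S := (ncseries K T).
Implicit Types (f g h y : S) (w : seq T) (x : T).

Lemma ncs_exp_val m f : f [::] = 0 ->
  ncs_val m (ncs_exp f - \sum_(j < m) (j`!%:R)^-1 *: f ^+ j).
Proof.
case: m => // m f0 w; rewrite ltnS => wm.
by rewrite -(horner_alg_poly _ (fun j => (j`!%:R)^-1)) !ncsE (ncs_exp_poly f0 wm) subrr.
Qed.

Lemma ncs_exp_trunc N f : f [::] = 0 ->
  ncs_eq N (ncs_exp f) (\sum_(j < N.+1) (j`!%:R)^-1 *: f ^+ j).
Proof.
by move=> f0 w wN; apply/eqP; rewrite -subr_eq0; apply/eqP; exact: (ncs_exp_val f0).
Qed.

(** Apply [derivation_expr] to each h^n / n! and exchange the sums: the k-th term becomes (ad h)^k
    (d h) / (k + 1)! times a truncation of e^h. *)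
Lemma ncs_delta_exp N y h : h [::] = 0 -> ncs_delta y h [::] = 0 ->
  ncs_eq N (ncs_delta y (ncs_exp h))
    ((\sum_(k < N.+1) (k.+1`!%:R)^-1 *: iter k (lie h) (ncs_delta y h)) * ncs_exp h).
Proof.
move=> h0 y0; apply: (ncs_eq_trans (ncs_delta_eq _ (ncs_exp_trunc h0))).
pose a k := iter k (lie h) (ncs_delta y h).
have -> : ncs_delta y (\sum_(j < N.+1) (j`!%:R)^-1 *: h ^+ j) =
    \sum_(k < N.+1) ((k.+1`!%:R)^-1 *: a k) * \sum_(j < N - k) (j`!%:R)^-1 *: h ^+ j.
  rewrite ncs_delta_sum.
  transitivity (\sum_(n < N.+1) \sum_(k < N.+1 | (k < n)%N)
      ((k.+1`!%:R)^-1 *: a k) * ((n - k.+1)`!%:R^-1 *: h ^+ (n - k.+1))).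
    apply: eq_bigr => n _; rewrite ncs_deltaZ.
    rewrite (derivation_expr _ _ (ncs_delta1 y) (@ncs_deltaM _ _ y)) scaler_sumr.
    rewrite (big_ord_widen N.+1 (fun k => (n`!%:R)^-1 *:
      ((a k * h ^+ (n - k.+1)) *+ 'C(n, k.+1)))); last by rewrite ltnW.
    apply: eq_bigr => k kn.
    rewrite -scaler_nat scalerA -scalerAl -scalerAr scalerA; congr (_ *: _).
    rewrite (binr_fact _ kn) mulrA mulrA mulVf ?factr_neq0 // mul1r.
    by [].
  rewrite (exchange_big_dep xpredT) //=; apply: eq_bigr => k _.
  rewrite -mulr_sumr; congr (_ * _).
  rewrite -(big_mkord (fun n => k < n)%N
    (fun n => ((n - k.+1)`!%:R)^-1 *: h ^+ (n - k.+1))).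
  rewrite -(big_nat_widenl k.+1 0 N.+1 xpredT) // -[k.+1 in LHS]add0n.
  rewrite big_addn subSS big_mkord.
  by apply: eq_bigr => j _; rewrite addnK.
(* The left factor has order at least k + 1 and the truncation error of e^h order at least N - k, so
   their product starts beyond degree N. *)
rewrite mulr_suml; apply: ncs_eq_sum => k w wN; apply/eqP; rewrite eq_sym -subr_eq0.
have := @ncs_valM _ _ k.+1 (N - k) _ _ _ (ncs_exp_val (m := N - k) h0).
move=> /(_ ((k.+1`!%:R)^-1 *: a k)) /(_ _ w); rewrite mulrBr !ncsE => -> //.
  by move=> v vk; rewrite ncsE [a k v](ncs_val_ad h0 y0 vk) mulr0.
by rewrite addSn ltnS subnKC // -ltnS.
Qed.
End ExpDerivation.

(** * The Hausdorff series is a Lie series *)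

Section Letters.
Variables (K : numFieldType) (T : eqType).
Local Notation S := (ncseries K T).
Local Notation gen := (ncs_gen K).
Implicit Types (f g : S) (w : seq T) (x y : T).

Lemma ncs_genM_nil x f : (gen x * f) [::] = 0.
Proof. by rewrite ncs_mulE big_ord1 mul0r. Qed.

Lemma ncs_genM_cons x f y w : (gen x * f) (y :: w) = (y == x)%:R * f w.
Proof.
rewrite ncs_mulE /= big_ord_recl mul0r add0r big_ord_recl /= take0 drop0.
rewrite big1 ?addr0 /ncs_gen /= => [|i _]; first by rewrite eqseq_cons eqxx andbT.
rewrite eqseq_cons [take _ w == _](_ : _ = false) ?andbF ?mul0r //.
by rewrite -size_eq0 size_takel //; case: i.
Qed.

Lemma ncs_gen_exprE x n w : (gen x ^+ n) w = (w == nseq n x)%:R.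
Proof.
elim: n w => [|n IH] [|y w] //; rewrite exprS ?ncs_genM_nil //.
by rewrite ncs_genM_cons IH /= eqseq_cons -natrM mulnb.
Qed.

Lemma ncs_exp_genE x w :
  ncs_exp (gen x) w = (w == nseq (size w) x)%:R / (size w)`!%:R.
Proof.
rewrite /ncs_exp big_ord_recr /= ncs_gen_exprE mulrC big1 ?add0r // => -[i /= iw] _.
rewrite ncs_gen_exprE [w == _](_ : _ = false) ?mulr0 //.
by apply/eqP => e; move: iw; rewrite e size_nseq ltnn.
Qed.

Lemma ncs_exp_nil f : ncs_exp f [::] = 1.
Proof. by rewrite /ncs_exp big_ord1 invr1 mul1r expr0 ncs1E. Qed.

Lemma ncs_euler_exp_gen x : ncs_euler (ncs_exp (gen x)) = gen x * ncs_exp (gen x).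
Proof.
apply/funext => -[|y w]; first by rewrite ncs_genM_nil /ncs_euler mul0r.
rewrite ncs_genM_cons /ncs_euler !ncs_exp_genE /= eqseq_cons.
rewrite -mulnb natrM factS natrM invfM.
by rewrite mulrCA -!mulrA; congr (_ * (_ * _)); rewrite mulrA divff ?pnatr_eq0 ?mul1r.
Qed.

(** Up to any given degree, e^f is a polynomial in f. *)
Lemma ncs_exp_comm f : f [::] = 0 -> f * ncs_exp f = ncs_exp f * f.
Proof.
move=> f0; apply/funext => w; set N := size w.
have e := ncs_exp_poly f0 (N := N); set p := horner_alg f _ in e.
have -> // : (f * ncs_exp f) w = (f * p) w by apply: (ncs_eqM _ e).
have -> // : (ncs_exp f * f) w = (p * f) w by apply: (ncs_eqM e).
congr (_ w); rewrite -{1 2}(horner_algX f) /p -!rmorphM mulrC //.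
Qed.

Lemma ncs_partM n f g :
  ncs_part n (f * g) = \sum_(i < n.+1) ncs_part i f * ncs_part (n - i) g.
Proof.
apply/funext => w; rewrite ncs_sumE /ncs_part; case: eqP => [wn|wn].
  rewrite ncs_mulE -{}wn; apply: eq_bigr => i _; rewrite ncs_mulE (bigD1 i) //=.
  have iw : (i <= size w)%N by rewrite -ltnS.
  rewrite size_takel // size_drop !eqxx big1 ?addr0 // => j ji.
  rewrite size_takel -1?ltnS //.
  by move: ji; rewrite -val_eqE => /negPf ->; rewrite mul0r.
rewrite big1 // => i _; rewrite ncs_mulE big1 // => j _.
have jw : (j <= size w)%N by rewrite -ltnS.
rewrite size_takel // size_drop; case: eqP => [ji|]; last by rewrite mul0r.
case: eqP => [e|]; last by rewrite mulr0.
by case: wn; rewrite -(subnKC jw) e ji subnKC // -ltnS.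
Qed.

Lemma ncs_part_lie n f g :
  ncs_part n (lie f g) = \sum_(i < n.+1) lie (ncs_part i f) (ncs_part (n - i) g).
Proof.
transitivity (ncs_part n (f * g) - ncs_part n (g * f)).
  have -> : lie f g = f * g - g * f by [].
  by apply/funext => w; rewrite !ncsE /ncs_part; case: eqP; rewrite ?ncsE ?subr0.
rewrite !ncs_partM [X in _ - X](reindex_inj rev_ord_inj) /= -sumrB.
apply: eq_bigr => i _; rewrite /lie /= /ncs_lie subSS subKn // -ltnS.
by [].
Qed.

Lemma ncs_partD n f g : ncs_part n (f + g) = ncs_part n f + ncs_part n g.
Proof. by apply/funext => w; rewrite ncsE /ncs_part; case: eqP; rewrite ?ncsE ?addr0. Qed.

Lemma ncs_partZ n a f : ncs_part n (a *: f) = a *: ncs_part n f.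
Proof. by apply/funext => w; rewrite ncsE /ncs_part; case: eqP; rewrite ?ncsE ?mulr0. Qed.

Lemma ncs_part_eq n f g : ncs_eq n f g -> ncs_part n f = ncs_part n g.
Proof.
by move=> e; apply/funext => w; rewrite /ncs_part; case: eqP => // wn; rewrite e ?wn.
Qed.

Lemma ncs_part_euler n f : ncs_part n (ncs_euler f) = n%:R *: ncs_part n f.
Proof.
by apply/funext => w; rewrite ncsE /ncs_part; case: eqP => [<-|]; rewrite ?mulr0.
Qed.

Lemma ncs_part0 f : f [::] = 0 -> ncs_part 0 f = 0.
Proof. by move=> f0; apply/funext => -[|x w]. Qed.

Lemma ncs_part_gen n x : ncs_part n (gen x) = if n == 1 then gen x else 0.
Proof.
apply/funext => w; rewrite /ncs_part /ncs_gen.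
have [->|wx] := eqVneq w [:: x]; first by rewrite eq_sym; case: eqP => // _; rewrite eqxx.
by case: ifP => _; case: ifP => // _; rewrite (negPf wx).
Qed.

End Letters.

Section LieMorphism.
Variables (K : fieldType) (L M : lieAlgType K) (f : L -> M).
Hypothesis fM : lie_morphism f.

Lemma lie_morphD x y : f (x + y) = f x + f y.
Proof. by have [fl _] := fM; have := fl 1 x y; rewrite !scale1r. Qed.

Lemma lie_morph0 : f 0 = 0.
Proof. by apply: (@addrI _ (f 0)); rewrite -lie_morphD !addr0. Qed.

Lemma lie_morphZ a x : f (a *: x) = a *: f x.
Proof. by have [fl _] := fM; rewrite -[a *: x]addr0 fl lie_morph0 addr0. Qed.

End LieMorphism.

Lemma homog_lie (K : fieldType) (L : lieAlgType K) (T : Type) (g : T -> L) m n x y :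
  homog g m x -> homog g n y -> homog g (m + n) (lie x y).
Proof.
elim=> [|a u v hu _ IH] hy; first by rewrite lie0l; left.
rewrite lie_linearl; apply: lspanD (IH hy); apply: lspanZ => {IH}.
elim: hy => [|b s t hs _ IH]; first by rewrite lie0r; left.
by rewrite lie_linearr; apply: lspan_incr IH; apply: bracket_lie.
Qed.

Section HausdorffLie.
Variable K : numFieldType.
Local Notation S := (ncseries K bool).
Implicit Types f g : S.

Let P : S := ncs_gen K false.
Let Q : S := ncs_gen K true.
Let h : S := hausdorff_ncs K.

Lemma envelL_morphism : lie_morphism (@envelL K).
Proof. exact: free_lift_morphism. Qed.

Lemma envelL_gen b : envelL (genL K b) = ncs_gen K b.
Proof. exact: free_lift_gen. Qed.

Lemma hausdorff_nil : h [::] = 0.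
Proof. by rewrite /h /hausdorff_ncs /ncs_log big_geq. Qed.

Lemma hausdorff_exp : ncs_exp h = ncs_exp P * ncs_exp Q.
Proof. by rewrite ncs_logK // ncs_mulE big_ord1 !ncs_exp_nil mulr1. Qed.

(** E gives P e^P e^Q + e^P Q e^Q. As Q commutes with e^Q, the last term cancels against the - e^P
    e^Q Q of ad Q, leaving Q e^P e^Q. *)
Lemma delta_exp : ncs_delta Q (ncs_exp h) = (P + Q) * ncs_exp h.
Proof.
rewrite hausdorff_exp /ncs_delta ncs_eulerM !ncs_euler_exp_gen.
rewrite (ncs_exp_comm (f := Q)) // /lie /= /ncs_lie !mulrA.
by rewrite 2!mulrDl -addrA; congr (_ + _); rewrite addrC subrK.
Qed.

(* The differential equation of H for the derivation d = E + ad Q, E being the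
   degree: (e^(ad H) - 1) / ad H sends d H to (d e^H) e^(-H) = P + Q. *)
Lemma hausdorff_ode N :
  ncs_eq N (\sum_(k < N.+1) (k.+1`!%:R)^-1 *: iter k (lie h) (ncs_delta Q h)) (P + Q).
Proof.
apply: (@ncs_mulIeq _ _ _ _ _ (ncs_exp h)); first exact: ncs_exp_nil.
rewrite -delta_exp; apply: ncs_eq_sym; apply: ncs_delta_exp; first exact: hausdorff_nil.
rewrite /ncs_delta ncsE /ncs_euler mul0r add0r /lie /= /ncs_lie !ncsE.
by rewrite !ncs_mulE !big_ord1 hausdorff_nil !(mul0r, mulr0) subrr.
Qed.

Definition is_lie n f := exists2 x, homog (genL K) n x & envelL x = f.

Lemma is_lie0 n : is_lie n 0.
Proof. by exists 0; [left | exact: (lie_morph0 envelL_morphism)]. Qed.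

Lemma is_lieD n f g : is_lie n f -> is_lie n g -> is_lie n (f + g).
Proof.
move=> [x hx <-] [y hy <-]; exists (x + y); first exact: lspanD.
exact: (lie_morphD envelL_morphism).
Qed.

Lemma is_lieZ n a f : is_lie n f -> is_lie n (a *: f).
Proof.
move=> [x hx <-]; exists (a *: x); first exact: lspanZ.
exact: (lie_morphZ envelL_morphism).
Qed.

Lemma is_lie_gen b : is_lie 1 (ncs_gen K b).
Proof. by exists (genL K b); [apply: lspan_in; left | exact: envelL_gen]. Qed.

Lemma is_lie_lie m n f g : is_lie m f -> is_lie n g -> is_lie (m + n) (lie f g).
Proof.
move=> [x hx <-] [y hy <-]; exists (lie x y); first exact: homog_lie.
by have [_ ->] := envelL_morphism.
Qed.

Definition lie_part n f := is_lie n (ncs_part n f).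

(** Without constant terms, the part of degree n of [f, g] involves only parts of degree below n. *)
Lemma lie_part_lie n f g : f [::] = 0 -> g [::] = 0 ->
  (forall m, (m < n)%N -> lie_part m f /\ lie_part m g) -> lie_part n (lie f g).
Proof.
move=> f0 g0 IH; rewrite /lie_part ncs_part_lie.
elim/big_ind: _ => [|u v|[i /= iN] _]; [exact: is_lie0 | exact: is_lieD |].
have [->|i0] := posnP i; first by rewrite ncs_part0 // lie0l; exact: is_lie0.
have [e|ni] := posnP (n - i)%N; first by rewrite e (ncs_part0 g0) lie0r; exact: is_lie0.
rewrite -[n in is_lie n](@subnKC i n) // ; apply: is_lie_lie.
  by have [] := IH i => //; rewrite -subn_gt0.
by have [] := IH (n - i)%N => //; rewrite ltn_subrL i0 (leq_trans ni) ?leq_subr.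
Qed.

Lemma lie_nil f g : f [::] = 0 -> g [::] = 0 -> lie f g [::] = 0.
Proof.
by move=> f0 g0; rewrite /lie /= /ncs_lie !ncsE !ncs_mulE !big_ord1 f0 g0 mulr0 subrr.
Qed.

Lemma lie_part_gen n b : lie_part n (ncs_gen K b).
Proof.
rewrite /lie_part ncs_part_gen; case: eqP => [->|_]; [exact: is_lie_gen | exact: is_lie0].
Qed.

(** Induction on a bound N for n: the outer bracket asks for the inner ones only in degrees below
    n. *)
Lemma lie_part_iter n k f g : f [::] = 0 -> g [::] = 0 ->
  (forall m, (m < n)%N -> lie_part m f /\ lie_part m g) ->
  lie_part n (iter k.+1 (lie f) g).
Proof.
move=> f0 g0; elim: n {-2}n (leqnn n) k => [|N IHN] n nN k IH.
  apply: lie_part_lie => //; first by elim: k => //= k; exact: lie_nil.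
  by move=> m mn; have := leq_trans mn nN.
apply: lie_part_lie => //; first by elim: k => //= k; exact: lie_nil.
move=> m mn; have [pf pg] := IH m mn; split => //.
case: k => // k; apply: IHN; first by rewrite -ltnS (leq_trans mn).
by move=> j jm; apply: IH; apply: ltn_trans mn.
Qed.

Lemma hausdorff_lie n : lie_part n h.
Proof.
elim/ltn_ind: n => n IH; case: n IH => [|n] IH.
  by rewrite /lie_part ncs_part0 ?hausdorff_nil //; exact: is_lie0.
have n0 : n.+1%:R != 0 :> K by rewrite pnatr_eq0.
(* E multiplies the part of degree n + 1 by n + 1, which is invertible, so E h may replace h. *)
rewrite /lie_part -[ncs_part _ _]scale1r -(mulVf n0) -scalerA -ncs_part_euler.
apply: is_lieZ; have h0 := hausdorff_nil.
have IHQ m : (m < n.+1)%N -> lie_part m Q /\ lie_part m h.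
  by move=> mn; split; [exact: lie_part_gen | exact: IH].
set y := ncs_delta Q h.
have y0 : y [::] = 0.
  by rewrite /y /ncs_delta ncsE lie_nil // addr0 /ncs_euler mul0r.
(* The term k = 0 of [hausdorff_ode] is E h + [Q, h]. Besides E h and P + Q only brackets occur, and
   these depend on lower degrees. *)
have -> : ncs_part n.+1 (ncs_euler h) = ncs_part n.+1 (P + Q) -
    ncs_part n.+1 (\sum_(k < n.+1) (k.+2`!%:R)^-1 *: iter k.+1 (lie h) y)
    - ncs_part n.+1 (lie Q h).
  rewrite -(ncs_part_eq (hausdorff_ode (N := n.+1))) -/y big_ord_recl /= invr1 scale1r.
  by rewrite ncs_partD addrK {1}/y /ncs_delta ncs_partD addrK.
have lN f : lie_part n.+1 f -> is_lie n.+1 (- ncs_part n.+1 f).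
  by rewrite -scaleN1r; exact: is_lieZ.
apply: is_lieD; last by apply: lN; exact: lie_part_lie.
apply: is_lieD; first by rewrite ncs_partD; apply: is_lieD; exact: lie_part_gen.
apply: lN; rewrite /lie_part.
elim/big_ind: _ => [|u v hu hv|k _].
- by rewrite -(scale0r 0) ncs_partZ scale0r; exact: is_lie0.
- by rewrite ncs_partD; exact: is_lieD.
rewrite ncs_partZ; apply: is_lieZ; apply: lie_part_iter => // m mn.
split; first exact: IH.
rewrite /lie_part /y /ncs_delta ncs_partD ncs_part_euler.
apply: is_lieD; first by apply: is_lieZ; exact: IH.
by apply: lie_part_lie => // j jm; apply: IHQ; exact: ltn_trans mn.
Qed.

End HausdorffLie.

(** * The free Lie algebra embeds in its enveloping algebra *)

Section Shifts.
Variables (K : fieldType) (T : eqType).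
Local Notation S := (ncseries K T).
Implicit Types (f g : S) (w : seq T) (x y : T).

(** The Fox derivative d_x: the left cofactor of x in the words ending in x. *)
Definition ncs_rshift x f : S := fun w => f (rcons w x).

Lemma ncs_shiftM x f g :
  ncs_shift x (f * g) = f [::] *: ncs_shift x g + ncs_shift x f * g.
Proof. by apply/funext => w; rewrite /ncs_shift [LHS]ncs_mul_cons. Qed.

Lemma ncs_rshiftM x f g :
  ncs_rshift x (f * g) = f * ncs_rshift x g + g [::] *: ncs_rshift x f.
Proof.
apply/funext => w; rewrite /ncs_rshift !ncsE !ncs_mulE size_rcons big_ord_recr /=.
rewrite take_oversize ?drop_oversize ?size_rcons // [g _ * _]mulrC; congr (_ + _).
apply: eq_bigr => i _; have iw : (i <= size w)%N by rewrite -ltnS.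
rewrite -cats1 take_cat drop_cat; have [iw'|iw'] := ltnP i (size w).
  by rewrite cats1.
have -> : i = size w :> nat by apply/eqP; rewrite eqn_leq iw.
by rewrite subnn take0 drop0 cats0 take_size drop_size.
Qed.

Definition ncs_hom (m : nat) f := forall w, size w != m -> f w = 0.

Lemma ncs_hom_gen x : ncs_hom 1 (ncs_gen K x).
Proof. by move=> w w1; rewrite /ncs_gen; case: eqP => // e; move: w1; rewrite e. Qed.

Lemma ncs_homM m n f g : ncs_hom m f -> ncs_hom n g -> ncs_hom (m + n) (f * g).
Proof.
move=> hf hg w wmn; rewrite ncs_mulE big1 // => i _.
have iw : (i <= size w)%N by rewrite -ltnS.
have [im|im] := eqVneq (i : nat) m; last by rewrite hf ?mul0r // size_takel.
by rewrite hg ?mulr0 // size_drop; apply: contraNneq wmn => <-; rewrite -im subnKC.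
Qed.

Lemma ncs_hom_linear m a f g : ncs_hom m f -> ncs_hom m g -> ncs_hom m (a *: f + g).
Proof. by move=> hf hg w wm; rewrite !ncsE hf // hg // mulr0 addr0. Qed.

Lemma ncs_hom_lie m n f g : ncs_hom m f -> ncs_hom n g -> ncs_hom (m + n) (lie f g).
Proof.
move=> hf hg; rewrite [lie f g](_ : _ = (-1) *: (g * f) + f * g).
  by apply: ncs_hom_linear; [rewrite addnC|]; apply: ncs_homM.
by rewrite scaleN1r addrC.
Qed.

Lemma ncs_hom_shift m x f : ncs_hom m.+1 f -> ncs_hom m (ncs_shift x f).
Proof. by move=> hf w wm; apply: hf. Qed.

End Shifts.

Section Dynkin.
Variable K : numFieldType.
Local Notation S := (ncseries K bool).
Local Notation L := (freeL K).
Implicit Types (f g : S) (x y u v : L).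

(* The action on L of the homogeneous part of degree n of f, the letters acting
   by their adjoint maps. *)
Fixpoint ncs_act n f y : L :=
  if n is m.+1 then \sum_(b : bool) lie (genL K b) (ncs_act m (ncs_shift b f) y)
  else f [::] *: y.

(* The linear map sending a word x_1 ... x_n to [x_1 ... x_n]. *)
Definition dynkin n f : L :=
  if n is m.+1 then \sum_(b : bool) ncs_act m (ncs_rshift b f) (genL K b) else 0.

Lemma ncs_act_linearl n a f g y :
  ncs_act n (a *: f + g) y = a *: ncs_act n f y + ncs_act n g y.
Proof.
elim: n f g => [|n IH] f g /=; first by rewrite !ncsE scalerDl scalerA.
rewrite scaler_sumr -big_split; apply: eq_bigr => b _.
by rewrite /= -lie_linearr -IH.
Qed.

Lemma ncs_act0 n f : ncs_act n f 0 = 0.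
Proof.
by elim: n f => [|n IH] f /=; rewrite ?scaler0 // big1 // => b _; rewrite IH lie0r.
Qed.

Lemma ncs_actZr n f a y : ncs_act n f (a *: y) = a *: ncs_act n f y.
Proof.
elim: n f => [|n IH] f /=; first by rewrite !scalerA mulrC.
by rewrite scaler_sumr; apply: eq_bigr => b _; rewrite IH lieZr.
Qed.

Lemma ncs_actDr n f y z : ncs_act n f (y + z) = ncs_act n f y + ncs_act n f z.
Proof.
elim: n f => [|n IH] f /=; first by rewrite scalerDr.
by rewrite -big_split; apply: eq_bigr => b _; rewrite IH lieDr.
Qed.

Lemma ncs_act0l n y : ncs_act n 0 y = 0.
Proof.
by have := ncs_act_linearl n (-1) 0 0 y; rewrite scaler0 addr0 scaleN1r addNr.
Qed.

(** The action is multiplicative; homogeneity of f makes the cut after m letters the only one that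
    counts. *)
Lemma ncs_actM m n f g y : ncs_hom m f ->
  ncs_act (m + n) (f * g) y = ncs_act m f (ncs_act n g y).
Proof.
elim: m f => [|m IH] f hf.
  rewrite /= (_ : f * g = f [::] *: g + 0) ?ncs_act_linearl ?ncs_act0l ?addr0 //.
  apply/funext => w; rewrite ncs_mulE big_ord_recl take0 drop0 /= big1 ?addr0 // => i _.
  by rewrite hf ?mul0r // size_takel.
rewrite addSn /=; apply: eq_bigr => b _; rewrite ncs_shiftM ncs_act_linearl.
by rewrite hf // scale0r add0r IH //; exact: ncs_hom_shift.
Qed.

(** As n > 0, the innermost letter comes from g, and f acts on the result. *)
Lemma dynkinM m n f g : (0 < n)%N -> ncs_hom m f -> ncs_hom n g ->
  dynkin (m + n) (f * g) = ncs_act m f (dynkin n g).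
Proof.
case: n => // n _ hf hg; rewrite addnS /=.
rewrite (big_morph (ncs_act m f) (@ncs_actDr m f) (ncs_act0 m f)).
apply: eq_bigr => b _; rewrite ncs_rshiftM hg // scale0r addr0.
exact: ncs_actM.
Qed.

Lemma dynkin_linear n a f g : dynkin n (a *: f + g) = a *: dynkin n f + dynkin n g.
Proof.
case: n => [|n] /=; first by rewrite scaler0 addr0.
by rewrite scaler_sumr -big_split; apply: eq_bigr => b _; rewrite /= -ncs_act_linearl.
Qed.

Lemma envelL_lie x y : envelL (lie x y) = envelL x * envelL y - envelL y * envelL x.
Proof. by have [_ ->] := envelL_morphism K. Qed.

Lemma bracket_gt0 n u : bracket_of (genL K) n u -> (0 < n)%N.
Proof. by elim=> // m p ? ? _ m0 _ _; rewrite addn_gt0 m0. Qed.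

Lemma envelL_hom n u : bracket_of (genL K) n u -> ncs_hom n (envelL u).
Proof.
elim=> [b|m p x y _ hx _ hy]; first by rewrite envelL_gen; exact: ncs_hom_gen.
by rewrite envelL_lie; exact: ncs_hom_lie.
Qed.

(** By the Jacobi identity, ad [u, v] is the commutator of ad u and ad v. *)
Lemma ncs_act_envelL n u y : bracket_of (genL K) n u -> ncs_act n (envelL u) y = lie u y.
Proof.
move=> hu; elim: hu y => [b y|m p u' v hu IHu hv IHv y].
  rewrite envelL_gen /= (bigD1 b) //= big1 ?addr0 => [|c cb].
    by rewrite /ncs_shift /ncs_gen eqxx scale1r.
  by rewrite /ncs_shift /ncs_gen eqseq_cons (negPf cb) scale0r lie0r.
rewrite envelL_lie addrC -scaleN1r ncs_act_linearl.
rewrite (ncs_actM _ _ _ (envelL_hom hu)) addnC (ncs_actM _ _ _ (envelL_hom hv)).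
by rewrite !(IHu, IHv) scaleN1r addrC [lie u' (lie v y)]lie_leibniz addrK.
Qed.

(* dynkin \o envelL is a derivation of L which fixes the generators. *)
Lemma dynkin_envelL n u : homog (genL K) n u -> dynkin n (envelL u) = n%:R *: u.
Proof.
have e0 : envelL (0 : L) = 0 := lie_morph0 (envelL_morphism K).
have [el _] := envelL_morphism K.
elim=> [|a x y hx _ IH].
  rewrite e0 scaler0; have := dynkin_linear n (-1) 0 0.
  by rewrite scaler0 addr0 scaleN1r addNr.
rewrite el dynkin_linear IH scalerDr scalerA mulrC -scalerA; congr (_ *: _ + _).
elim: hx => [b|m p u' v hu IHu hv IHv].
  rewrite envelL_gen /= (bigD1 b) //= big1 ?addr0 => [|c cb].
    by rewrite /ncs_rshift /ncs_gen eqxx.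
  by rewrite /ncs_rshift /ncs_gen eqseq_cons (negPf cb) scale0r.
have [hu' hv'] := (envelL_hom hu, envelL_hom hv).
have := dynkinM (bracket_gt0 hu) hv' hu'; rewrite addnC => dvu.
rewrite envelL_lie addrC -scaleN1r dynkin_linear.
(* The value is [u', p v] - [v, m u'] = (m + p) [u', v]. *)
rewrite (dynkinM (bracket_gt0 hv) hu' hv') dvu IHu IHv.
rewrite !ncs_actZr (ncs_act_envelL _ hu) (ncs_act_envelL _ hv) [lie v u']lieC.
by rewrite scaleN1r scalerN opprK -scalerDl natrD.
Qed.

Lemma homog_gen0 u : homog (genL K) 0 u -> u = 0.
Proof.
elim=> // a x y hx _ _; move: hx; set z := 0%N => hx.
by have := bracket_gt0 hx.
Qed.

Lemma envelL_inj n u v : homog (genL K) n u -> homog (genL K) n v ->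
  envelL u = envelL v -> u = v.
Proof.
case: n => [/homog_gen0 -> /homog_gen0 -> //|n hu hv e].
have n0 : n.+1%:R != 0 :> K by rewrite pnatr_eq0.
by apply: (scalerI n0); rewrite -!dynkin_envelL // e.
Qed.

End Dynkin.

(** * Fox derivatives and the free metabelian Lie algebra *)

Section Abelianization.
Variable K : fieldType.
Local Notation S := (ncseries K bool).
Implicit Types (f g : S) (b : bool).

Definition letter_wt b : {poly K} := if b then 1 else 'X.

(* The homogeneous part of degree n of the image of f in K[[p, q]], the
   monomial p^a q^(n - a) being written 'X^a. *)
Fixpoint abel n f : {poly K} :=
  if n is m.+1 then \sum_(b : bool) letter_wt b * abel m (ncs_shift b f)
  else (f [::])%:P.

Lemma abel_linear n a f g : abel n (a *: f + g) = a *: abel n f + abel n g.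
Proof.
elim: n f g => [|n IH] f g /=; first by rewrite !ncsE polyCD polyCM mul_polyC.
rewrite scaler_sumr -big_split; apply: eq_bigr => b _ /=.
by rewrite scalerAr -mulrDr -IH.
Qed.

Lemma abel0 n : abel n 0 = 0.
Proof. by have := abel_linear n (-1) 0 0; rewrite scaler0 addr0 scaleN1r addNr. Qed.

Lemma abelZ n a f : abel n (a *: f) = a *: abel n f.
Proof. by rewrite -[a *: f]addr0 abel_linear abel0 addr0. Qed.

Lemma abel_sum n m (F : 'I_m -> S) :
  abel n (\sum_(i < m) F i) = \sum_(i < m) abel n (F i).
Proof.
elim: m F => [|m IH] F; first by rewrite !big_ord0 abel0.
by rewrite !big_ord_recl -IH -{1}(scale1r (F _)) abel_linear scale1r.
Qed.

Lemma eq_abel n f g : (forall w, size w = n -> f w = g w) -> abel n f = abel n g.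
Proof.
elim: n f g => [|n IH] f g fg /=; first by rewrite fg.
by apply: eq_bigr => b _; congr (_ * _); apply: IH => w wn; apply: fg; rewrite /= wn.
Qed.

Lemma abel_hom m n f : ncs_hom m f -> m != n -> abel n f = 0.
Proof.
by move=> hf mn; rewrite -(abel0 n); apply: eq_abel => w wn; rewrite hf // wn eq_sym.
Qed.

Lemma abelM n f g : abel n (f * g) = \sum_(k < n.+1) abel k f * abel (n - k) g.
Proof.
elim: n f g => [|n IH] f g; first by rewrite big_ord1 /= ncs_mulE big_ord1 polyCM.
rewrite big_ord_recl [abel 0 f]/= mul_polyC /= scaler_sumr.
transitivity (\sum_b (f [::] *: (letter_wt b * abel n (ncs_shift b g)) +
  \sum_(k < n.+1) letter_wt b * abel k (ncs_shift b f) * abel (n - k) g)).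
  apply: eq_bigr => b _; rewrite ncs_shiftM abel_linear IH mulrDr scalerAr; congr (_ + _).
  by rewrite mulr_sumr; apply: eq_bigr => k _; rewrite mulrA.
rewrite big_split /= exchange_big /=; congr (_ + _); apply: eq_bigr => k _.
by rewrite mulr_suml.
Qed.

Lemma abelM_hom m n f g : ncs_hom m f -> abel (m + n) (f * g) = abel m f * abel n g.
Proof.
move=> hf; rewrite abelM (bigD1 (Ordinal (leq_addr n m : m < (m + n).+1)%N)) //=.
rewrite addKn big1 ?addr0 // => k km; rewrite (abel_hom hf) ?mul0r //.
by rewrite eq_sym; apply: contraNneq km => e; apply/eqP/val_inj.
Qed.

Lemma abelC n f g : abel n (f * g) = abel n (g * f).
Proof.
rewrite !abelM (reindex_inj rev_ord_inj) /=; apply: eq_bigr => k _.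
by rewrite subSS subKn 1?mulrC // -ltnS.
Qed.

Lemma abel_lie n f g : abel n (lie f g) = 0.
Proof.
rewrite [lie f g](_ : _ = (-1) *: (g * f) + f * g); last by rewrite scaleN1r addrC.
by rewrite abel_linear abelC scaleN1r addNr.
Qed.

Lemma abel_gen b : abel 1 (ncs_gen K b) = letter_wt b.
Proof.
rewrite /= (bigD1 b) //= big1 ?addr0 => [|c cb]; rewrite /ncs_shift /ncs_gen.
  by rewrite eqxx mulr1.
by rewrite eqseq_cons (negPf cb) mulr0.
Qed.

Lemma abel_power n (c : K) f :
  (forall w, size w = n -> f w = (w == nseq n false)%:R * c) -> abel n f = c *: 'X^n.
Proof.
elim: n f => [|n IH] f hf /=.
  by rewrite hf // eqxx mul1r expr0 alg_polyC.
rewrite (bigD1 false) //= (IH (ncs_shift false f)) => [|w wn]; last first.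
  by rewrite /ncs_shift hf /= ?wn // eqseq_cons eqxx.
rewrite -scalerAr -exprS big1 ?addr0 // => -[] // _.
suff -> : abel n (ncs_shift true f) = abel n 0 by rewrite abel0 mulr0.
by apply: eq_abel => w wn; rewrite /ncs_shift hf /= ?wn // mul0r.
Qed.

End Abelianization.

(** * Long commutators in the free metabelian Lie algebra *)

Section Metabelian.
Variable K : fieldType.
Local Notation M := (metaL K).
Local Notation L := (freeL K).
Local Notation P := (genM K false).
Local Notation Q := (genM K true).

Lemma meta_lie_lie (x y u v : M) : lie (lie x y) (lie u v) = 0.
Proof.
elim/lquotW: x => x; elim/lquotW: y => y; elim/lquotW: u => u; elim/lquotW: v => v.
have [_ e] := projL_morphism K.
transitivity (projL (lie (lie x y) (lie u v))); first by rewrite !e.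
apply/lquot_piP; rewrite subr0; apply: lspan_in.
by exists (lie x y), (lie u v); split=> //; exact: derived_lie.
Qed.

(** For z in the derived algebra, [x, [y, z]] - [y, [x, z]] = [[x, y], z] = 0, and every iterate is
    again a bracket. *)
Lemma meta_ad_comm (x y : M) k (u v : M) :
  lie x (iter k (lie y) (lie u v)) = iter k (lie y) (lie x (lie u v)).
Proof.
have [a [b ->]] : exists a b, lie u v = lie a b by exists u, v.
elim: k => //= k <-.
have [c [d ->]] : exists c d, iter k (lie y) (lie a b) = lie c d.
  by case: k => [|k]; [exists a, b | exists y, (iter k (lie y) (lie a b))].
by rewrite lie_leibniz meta_lie_lie add0r.
Qed.

Lemma lie_long_commP m n : (0 < m)%N ->
  lie P (long_comm P Q m n) = long_comm P Q m.+1 n.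
Proof.
case: m => // m _; rewrite /long_comm /=.
by case: m => [|m]; rewrite [X in lie P X]/= meta_ad_comm.
Qed.

Lemma lie_long_commQ m n : (0 < n)%N ->
  lie Q (long_comm P Q m n) = long_comm P Q m n.+1.
Proof. by case: n. Qed.

(** The inverse of the Fox derivative in degree n: [Q^(n-m-1) P^(m-1) Q P] has Fox derivative
    p^(m-1) q^(n-m), written X^(m-1). *)
Definition meta_poly n (p : {poly K}) : M :=
  \sum_(1 <= m < n) p`_m.-1 *: long_comm P Q m (n - m).

Lemma meta_poly_linear n a p q :
  meta_poly n (a *: p + q) = a *: meta_poly n p + meta_poly n q.
Proof.
rewrite /meta_poly scaler_sumr -big_split; apply: eq_bigr => m _ /=.
by rewrite coefD coefZ scalerDl scalerA.
Qed.

Lemma meta_polyN n p : meta_poly n (- p) = - meta_poly n p.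
Proof.
rewrite /meta_poly -sumrN; apply: eq_bigr => m _.
by rewrite coefN scaleNr.
Qed.

Lemma meta_poly0 n : meta_poly n 0 = 0.
Proof. by rewrite /meta_poly big1 // => m _; rewrite coef0 scale0r. Qed.

Lemma lie_meta_poly b n (p : {poly K}) : (size p < n)%N ->
  lie (genM K b) (meta_poly n p) = meta_poly n.+1 (letter_wt K b * p).
Proof.
move=> pn; have n0 : (0 < n)%N by apply: leq_trans pn.
rewrite /meta_poly (big_morph (lie (genM K b)) (lieDr _) (lie0r _)).
case: b => /=.
  (* For the letter Q, the new top index m = n carries p_(n-1), zero by the size bound. *)
  rewrite mul1r [RHS]big_nat_recr //= [p`_ _]nth_default -1?ltnS ?prednK // scale0r addr0.
  rewrite !big_nat; apply: eq_bigr => m /andP[m0 mn].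
  by rewrite lieZr lie_long_commQ ?subSn ?subn_gt0 // ltnW.
rewrite [RHS]big_ltn // coefXM eqxx scale0r add0r [RHS]big_add1 /=.
rewrite !big_nat; apply: eq_bigr => m /andP[m0 mn].
by rewrite lieZr lie_long_commP // coefXM subSS -[m == 0]negbK -lt0n m0.
Qed.

End Metabelian.

(** * The Fox derivative determines the metabelian class *)

Section Fox.
Variable K : numFieldType.
Local Notation S := (ncseries K bool).
Local Notation M := (metaL K).
Local Notation L := (freeL K).
Local Notation P := (genM K false).
Local Notation Q := (genM K true).

(** The image of d_P f for the part of degree n of f; removing the last letter lowers the degree by
    one. *)
Definition fox n (f : S) : {poly K} := abel n.-1 (ncs_rshift false f).

Lemma fox_linear n a f g : fox n (a *: f + g) = a *: fox n f + fox n g.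
Proof. by rewrite /fox -abel_linear. Qed.

Lemma foxM m n f g : (0 < n)%N -> ncs_hom m f -> ncs_hom n g ->
  fox (m + n) (f * g) = abel m f * fox n g.
Proof.
case: n => // n _ hf hg; rewrite /fox addnS /= ncs_rshiftM hg // scale0r addr0.
exact: abelM_hom.
Qed.

Lemma fox_lie m n (f g : S) : (0 < m)%N -> (0 < n)%N -> ncs_hom m f -> ncs_hom n g ->
  fox (m + n) (lie f g) = abel m f * fox n g - abel n g * fox m f.
Proof.
move=> m0 n0 hf hg; rewrite -!foxM //.
rewrite [lie f g](_ : _ = (-1) *: (g * f) + f * g); last by rewrite scaleN1r addrC.
by rewrite fox_linear scaleN1r addrC [(n + m)%N]addnC.
Qed.

Lemma fox_gen b : fox 1 (ncs_gen K b) = (~~ b)%:R.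
Proof. by case: b; rewrite /fox /= /ncs_rshift /ncs_gen /=. Qed.

Lemma abel_bracket n u : (1 < n)%N -> bracket_of (genL K) n u -> abel n (envelL u) = 0.
Proof.
move=> n1 hu; case: hu n1 => // i j v w _ _ _.
by rewrite envelL_lie [_ - _](_ : _ = lie (envelL v) (envelL w)) ?abel_lie.
Qed.

Lemma bracket1 u : bracket_of (genL K) 1 u -> exists b, u = genL K b.
Proof.
move: {1 3}1%N (erefl 1%N) => n n1 hu.
case: hu n1 => [b|i j v w hv hw] n1; first by exists b.
by move: n1 (bracket_gt0 hv) (bracket_gt0 hw); case: i {hv} => [|[|i]]; case: j {hw}.
Qed.

Lemma bracket_derived n u : (1 < n)%N -> bracket_of (genL K) n u ->
  exists x y, projL u = lie x y.
Proof.
move=> n1 hu; case: hu n1 => // i j v w _ _ _; exists (projL v), (projL w).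
by have [_ ->] := projL_morphism K.
Qed.

(** The size bound is what [lie_meta_poly] requires, so it is carried along in the induction. *)
Definition fox_spec n (u : L) :=
  (size (fox n (envelL u)) < n)%N /\ projL u = meta_poly n (fox n (envelL u)).

Lemma fox_specN n u : fox_spec n u -> fox_spec n (- u).
Proof.
have eN : envelL (- u) = - envelL u.
  by rewrite -scaleN1r (lie_morphZ (envelL_morphism K)) scaleN1r.
have pN : projL (- u) = - projL u.
  by rewrite -scaleN1r (lie_morphZ (projL_morphism K)) scaleN1r.
have fN : fox n (- envelL u) = - fox n (envelL u).
  by rewrite -[- _]addr0 -scaleN1r fox_linear /fox [X in _ + X]abel0 addr0 scaleN1r.
by move=> [sz e]; split; rewrite eN fN ?size_polyN // pN meta_polyN e.
Qed.

(** Of the two terms of [fox_lie] only letter times d_P u survives, since u has abelian image 0. *)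
Lemma fox_spec_gen n b u : (1 < n)%N -> bracket_of (genL K) n u -> fox_spec n u ->
  fox_spec n.+1 (lie (genL K b) u).
Proof.
move=> n1 hu [sz e]; have n0 := ltnW n1.
have fE : fox n.+1 (envelL (lie (genL K b) u)) = letter_wt K b * fox n (envelL u).
  rewrite envelL_lie envelL_gen -add1n.
  rewrite [X in fox _ X](_ : _ = lie (ncs_gen K b) (envelL u)) //.
  rewrite fox_lie //; last exact: envelL_hom; last exact: ncs_hom_gen.
  by rewrite (abel_bracket n1 hu) mul0r subr0 abel_gen.
split; rewrite fE.
  case: b {fE} => /=; first by rewrite mul1r leqW.
  by rewrite mulrC; apply: leq_ltn_trans (size_polyMleq _ _) _; rewrite size_polyX addn2.
have [_ ->] := projL_morphism K.
by rewrite e lie_meta_poly.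
Qed.

(* d_P vanishes on brackets of two elements of [L, L], and d_P [x, u] = x d_P u
   for a letter x and u in [L, L]. *)
Lemma fox_bracket n u : bracket_of (genL K) n u -> (1 < n)%N -> fox_spec n u.
Proof.
elim=> // i j v w hv IHv hw IHw ij.
have [i0 j0] := (bracket_gt0 hv, bracket_gt0 hw).
have [i1|i1] := ltnP 1 i; last first.
  have {i0 i1} ei : i = 1%N by apply/eqP; rewrite eqn_leq i1.
  rewrite {}ei in hv IHv ij *; have [b eb] := bracket1 hv.
  have [j1|j1] := ltnP 1 j.
    by rewrite eb add1n; apply: fox_spec_gen => //; exact: IHw.
  have {j0 j1} ej : j = 1%N by apply/eqP; rewrite eqn_leq j1.
  rewrite {}ej in hw IHw ij *; have [c ec] := bracket1 hw.
  have fE : fox 2 (envelL (lie v w)) =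
      letter_wt K b * (~~ c)%:R - letter_wt K c * (~~ b)%:R.
    rewrite envelL_lie eb ec !envelL_gen.
    rewrite [X in fox _ X](_ : _ = lie (ncs_gen K b) (ncs_gen K c)) //.
    by rewrite (@fox_lie 1 1) ?abel_gen ?fox_gen //; exact: ncs_hom_gen.
  rewrite /fox_spec fE eb ec; have [_ ->] := projL_morphism K.
  rewrite /meta_poly big_nat1 /=.
  case: b c {eb ec fE} => [] [] /=; rewrite ?(mulr0, mulr1, subr0, sub0r, subrr).
  - by rewrite size_poly0 coef0 scale0r liexx.
  - by rewrite size_poly1 coef1 scale1r.
  - by rewrite size_polyN size_poly1 coefN coef1 scaleN1r lieC.
  - by rewrite size_poly0 coef0 scale0r liexx.
have [j1|j1] := ltnP 1 j; last first.
  have {j0 j1} ej : j = 1%N by apply/eqP; rewrite eqn_leq j1.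
  rewrite {}ej in hw IHw ij *; have [b ->] := bracket1 hw.
  by rewrite lieC addn1; apply: fox_specN; apply: fox_spec_gen => //; exact: IHv.
have fE : fox (i + j) (envelL (lie v w)) = 0.
  rewrite envelL_lie [X in fox _ X](_ : _ = lie (envelL v) (envelL w)) //.
  rewrite fox_lie //; try exact: envelL_hom.
  by rewrite (abel_bracket i1 hv) (abel_bracket j1 hw) !mul0r subr0.
rewrite /fox_spec fE size_poly0 meta_poly0 addn_gt0 i0; split => //.
have [_ ->] := projL_morphism K.
have [[x [y ->]] [x' [y' ->]]] := (bracket_derived i1 hv, bracket_derived j1 hw).
exact: meta_lie_lie.
Qed.

Lemma projL_fox n u : (1 < n)%N -> homog (genL K) n u ->
  projL u = meta_poly n (fox n (envelL u)).
Proof.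
move=> n1; have eM := envelL_morphism K; have pM := projL_morphism K.
elim=> [|a x y hx _ IH].
  by rewrite (lie_morph0 pM) (lie_morph0 eM) [fox _ _]abel0 meta_poly0.
have [el _] := eM; have [pl _] := pM; rewrite el pl fox_linear meta_poly_linear IH.
by have [_ ->] := fox_bracket hx n1.
Qed.

Lemma abel_homog n u : (1 < n)%N -> homog (genL K) n u -> abel n (envelL u) = 0.
Proof.
move=> n1; have eM := envelL_morphism K.
elim=> [|a x y hx _ IH]; first by rewrite (lie_morph0 eM) abel0.
by have [el _] := eM; rewrite el abel_linear IH addr0 (abel_bracket n1 hx) scaler0.
Qed.

End Fox.

(** * The Fox derivative of the Hausdorff series *)

Section HausdorffFox.
Variables (K : numFieldType) (B : nat -> K).
Hypothesis hB : is_bernoulli B.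
Local Notation S := (ncseries K bool).
Implicit Types f g : S.

Let P : S := ncs_gen K false.
Let Q : S := ncs_gen K true.
Let h : S := hausdorff_ncs K.

Lemma hausdorff_part1 : ncs_part 1 h = P + Q.
Proof.
have e x : h [:: x] = 1.
  rewrite /h /hausdorff_ncs /ncs_log big_nat1 expr0 divr1 mul1r expr1 !ncsE ncs1E subr0.
  rewrite ncs_mulE big_ord_recl big_ord1 /= !ncs_exp_genE /= invr1 !mulr1.
  by case: x; rewrite !(mulr1, mul1r, mul0r, mulr0, addr0, add0r).
apply/funext => -[|x [|y w]]; rewrite !ncsE /ncs_part /P /Q /ncs_gen /=.
- by rewrite addr0.
- by rewrite e; case: x; rewrite ?addr0 ?add0r.
- by rewrite !eqseq_cons !andbF addr0.
Qed.

(** h is a Lie series, and Lie elements of degree at least 2 vanish in K[[p, q]]; what remains is p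
    + q. *)
Lemma hausdorff_abel n : abel n h = if n == 1 then 'X + 1 else 0.
Proof.
have pn : abel n h = abel n (ncs_part n h).
  by apply: eq_abel => w wn; rewrite /ncs_part wn eqxx.
case: n pn => [|[|n]] pn; first by rewrite /= /h hausdorff_nil.
  rewrite pn hausdorff_part1 -(scale1r P) abel_linear scale1r !abel_gen.
  by [].
by have [x hx e] := hausdorff_lie K n.+2; rewrite pn -e abel_homog.
Qed.

Lemma hausdorff_abelX n j f :
  abel n (h ^+ j * f) = if (j <= n)%N then ('X + 1) ^+ j * abel (n - j) f else 0.
Proof.
elim: j n f => [|j IH] n f; first by rewrite expr0 !mul1r subn0.
rewrite exprS -mulrA abelM big_ord_recl hausdorff_abel mul0r add0r.
case: n => [|n]; first by rewrite big_ord0.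
rewrite big_ord_recl hausdorff_abel [_ == 1]/= subn1 big1 ?addr0 => [|k _]; last first.
  by rewrite hausdorff_abel mul0r.
by rewrite IH ltnS subSS; case: ifP; rewrite ?mulr0 // exprS mulrA.
Qed.

(** No word of e^Q ends in P, so d_P (e^P e^Q) = d_P e^P, whose image is (e^p - 1) / p. *)
Lemma rshift_exp_hausdorff n :
  abel n (ncs_rshift false (ncs_exp h)) = (n.+1`!%:R)^-1 *: 'X^n.
Proof.
rewrite /h hausdorff_exp ncs_rshiftM ncs_exp_nil scale1r.
have -> : ncs_rshift false (ncs_exp (ncs_gen K true)) = 0.
  apply/funext => w; rewrite /ncs_rshift ncs_exp_genE size_rcons.
  rewrite [_ == _](_ : _ = false) ?mul0r //; apply/negP => /eqP /(congr1 (last true)).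
  by rewrite last_rcons; elim: (size w).
rewrite mulr0 add0r; apply: abel_power => w wn.
rewrite /ncs_rshift ncs_exp_genE size_rcons wn; congr (_%:R * _).
rewrite [nseq n.+1 _](_ : _ = rcons (nseq n false) false) ?eqseq_rcons ?eqxx ?andbT //.
by elim: (n) => //= m <-.
Qed.

(* With d_P (f g) = f d_P g when g has no constant term, d_P (e^H) =
   ((e^H - 1) / H) d_P H. *)
Lemma rshift_hausdorff N : ncs_eq N (ncs_rshift false h)
  (\sum_(j < N.+1) (B j / j`!%:R) *: (h ^+ j * ncs_rshift false (ncs_exp h))).
Proof.
have h0 := hausdorff_nil K; rewrite -/h in h0.
(* Truncations of (e^x - 1) / x and of its inverse x / (e^x - 1). *)
pose phi := \poly_(j < N.+1) (j.+1`!%:R)^-1 : {poly K}.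
pose beta := \poly_(j < N.+1) (B j / j`!%:R) : {poly K}.
have ePhi : ncs_eq N (ncs_rshift false (ncs_exp h))
    (horner_alg h phi * ncs_rshift false h).
  (* The bound is N + 1 because the right shift reads words one letter longer. *)
  move=> w wN; rewrite [LHS](ncs_exp_trunc (N := N.+1) h0) ?size_rcons //.
  rewrite big_ord_recl expr0 !ncsE ncs1E.
  case: w wN => [|x w] wN /=; rewrite ?mulr0 ?add0r;
  rewrite horner_alg_poly mulr_suml !ncs_sumE; apply: eq_bigr => j _;
  rewrite -scalerAl !ncsE /bump /= add1n; congr (_ * _);
  by have := ncs_rshiftM false (h ^+ j) h; rewrite h0 scale0r addr0 -exprSr => <-.
have eB : ncs_eq N (horner_alg h (beta * phi)) 1.
  rewrite -[X in ncs_eq N _ X](rmorph1 (horner_alg h)); apply: horner_alg_eq => // i iN.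
  rewrite coefM coef1 -(bernoulli_inv hB i); apply: eq_bigr => j _.
  have ji : (j <= i)%N by rewrite -ltnS.
  by rewrite !coef_poly !ltnS (leq_trans ji) // (leq_trans (leq_subr _ _)) // subSn.
apply: (@ncs_eq_trans _ _ _ _ (horner_alg h beta * ncs_rshift false (ncs_exp h)));
  last first.
  move=> w _; rewrite horner_alg_poly mulr_suml !ncs_sumE.
  by apply: eq_bigr => j _; rewrite -scalerAl.
apply: ncs_eq_sym.
apply: (@ncs_eq_trans _ _ _ _ (horner_alg h (beta * phi) * ncs_rshift false h)).
  by rewrite rmorphM -mulrA; apply: ncs_eqM.
by rewrite -[X in ncs_eq N _ X]mul1r; apply: ncs_eqM.
Qed.

(** The part of degree n of beta(p + q) (e^p - 1) / p, at q = 1. *)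
Lemma fox_hausdorff n : fox n.+1 h =
  \sum_(j < n.+1) (B j / j`!%:R / (n - j).+1`!%:R) *: (('X + 1) ^+ j * 'X^(n - j)).
Proof.
rewrite /fox /=.
have -> : abel n (ncs_rshift false h) = abel n
    (\sum_(j < n.+1) (B j / j`!%:R) *: (h ^+ j * ncs_rshift false (ncs_exp h))).
  by apply: eq_abel => w wn; apply: rshift_hausdorff; rewrite wn.
rewrite abel_sum; apply: eq_bigr => j _; rewrite abelZ hausdorff_abelX -ltnS ltn_ord.
by rewrite rshift_exp_hausdorff -scalerAr scalerA.
Qed.

Lemma coef_X1n j i : (('X + 1 : {poly K}) ^+ j)`_i = 'C(j, i)%:R.
Proof.
rewrite addrC exprDn coef_sum.
under eq_bigr => k _ do rewrite expr1n mul1r coefMn coefXn.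
have [ij|ij] := ltnP i j.+1; last first.
  rewrite bin_small // big1 // => k _; case: eqP => [e|]; last by rewrite mul0rn.
  by move: ij; rewrite e leqNgt ltn_ord.
rewrite (bigD1 (Ordinal ij)) //= eqxx big1 ?addr0 // => k ki.
by rewrite eq_sym [_ == _](_ : _ = false) ?mul0rn //; apply/negbTE.
Qed.

(** The coefficient of p^(m-1) q^n, compared with the closed form [ext_bernoulliE]. *)
Lemma coef_fox_hausdorff m n : (0 < m)%N -> (0 < n)%N ->
  (fox (m + n) h)`_m.-1 = ext_bernoulli B m n / (m`!%:R * n`!%:R).
Proof.
case: m => // a _ n0; rewrite addSn fox_hausdorff coef_sum ext_bernoulliE //=.
rewrite mulr_suml (reindex_inj rev_ord_inj) /=.
(* Here k is the exponent of p contributed by (e^p - 1) / p, hence at most a = m - 1. *)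
transitivity (\sum_(k < (a + n).+1 | (k < a.+1)%N)
   'C(a.+1, k.+1)%:R * B (n + (a - k))%N / (a.+1`!%:R * n`!%:R)).
  rewrite [RHS]big_mkcond; apply: eq_bigr => k _; rewrite subSS.
  have kan : (k <= a + n)%N by rewrite -ltnS.
  rewrite coefZ subKn // coefMXn ltnS [(a < k)%N]ltnNge.
  case: leqP => ka /=; last by rewrite mulr0.
  have -> : (a + n - k = n + (a - k))%N by rewrite -addnBAC // addnC.
  rewrite coef_X1n !binr_fact //; last by rewrite leq_addl.
  rewrite addnK subSS.
  have := (factr_neq0 K (n + (a - k)), factr_neq0 K k.+1, factr_neq0 K (a - k),
    factr_neq0 K n, factr_neq0 K a.+1) => -[[[[h1 h2] h3] h4] h5].
  by field; rewrite h1 h2 h3 h4 h5.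
rewrite -(big_ord_widen _ (fun k =>
  'C(a.+1, k.+1)%:R * B (n + (a - k))%N / (a.+1`!%:R * n`!%:R)));
  last by rewrite ltnS leq_addr.
rewrite (reindex_inj rev_ord_inj) /=; apply: eq_bigr => k _.
have ka : (k <= a)%N by rewrite -ltnS.
by rewrite subSS subKn // -subSn // bin_sub // ltnW.
Qed.

Lemma hausdorff_projL n (x : freeL K) : homog (genL K) n x -> envelL x = ncs_part n h ->
  projL x = meta_hausdorff_part B n.
Proof.
move=> hx e; have eM := envelL_morphism K; have pM := projL_morphism K.
rewrite /meta_hausdorff_part; case: n hx e => [|[|n]] hx e.
- by rewrite (homog_gen0 hx) (lie_morph0 pM) big_geq // addr0.
(* Degree 1 is treated apart, by injectivity in L, since d_P does not detect Q. *)
- rewrite (_ : x = genL K false + genL K true) ?(lie_morphD pM).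
    by rewrite big_nat1 big_mkcond big_nat1 addr0.
  apply: (envelL_inj hx); first by apply: lspanD; apply: lspan_in; left.
  by rewrite e hausdorff_part1 (lie_morphD eM) !envelL_gen.
(* The top value of m equals the degree and leaves no positive second index. *)
rewrite (projL_fox _ hx) // e add0r /meta_poly [RHS]big_nat_recr //=.
rewrite [X in _ = _ + X]big_nat_cond [X in _ = _ + X]big1 ?addr0
  => [|k /andP[/andP[k0 _] /eqP]]; last first.
  by move/eqP; rewrite -[X in _ == X]addn0 eqn_add2l => /eqP k'; rewrite k' in k0.
have -> : fox n.+2 (ncs_part n.+2 (hausdorff_ncs K)) = fox n.+2 h.
  rewrite /fox; apply: eq_abel => w wn.
  by rewrite /ncs_rshift /ncs_part size_rcons wn eqxx.
rewrite !big_nat; apply: eq_bigr => m /andP[m0 mn].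
have nm : (0 < n.+2 - m < n.+3)%N by rewrite subn_gt0 mn ltnS leq_subr.
(* For each other m, the inner sum has a single term. *)
rewrite (big_rem (n.+2 - m)%N); last by rewrite mem_index_iota.
rewrite subnKC ?eqxx 1?ltnW // big_seq_cond big1 ?addr0.
  rewrite -coef_fox_hausdorff //; last by case/andP: nm.
  by rewrite subnKC ?[RHS]addr0 // ltnW.
move=> k /andP[]; rewrite mem_rem_uniq ?iota_uniq // inE => /andP[/negP kn _] /eqP mk.
by case: kn; rewrite -mk addKn.
Qed.

End HausdorffFox.

Theorem proposition2p8 (R : realType) (B : nat -> R[i]) (hB : is_bernoulli B) :
  exists H, unique (@is_hausdorff _) H /\ projL_hat H = meta_hausdorff B.
Proof.
(* A preimage is chosen in each degree; injectivity of [envelL] makes it unique. *)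
pose c n := cid2 (hausdorff_lie R[i] n); pose H n := s2val (c n).
have HP n : homog (genL R[i]) n (H n) := s2valP (c n).
have eH n : envelL (H n) = ncs_part n (hausdorff_ncs R[i]) := s2valP' (c n).
exists (FormalSeries HP); split; last first.
  by apply: formal_seriesP => n; exact: (hausdorff_projL hB (HP n) (eH n)).
split=> // G eG; apply: formal_seriesP => n.
by apply: (envelL_inj (HP n) (fs_homog G n)); rewrite eG eH.
Qed.
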